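(* Let $K$ be a field and $A = K[x_1,\dots,x_n]$. Let $F \in A^{l\times l}$ with $\det(F) = p^t$, where $p \in K[x_1]$ is an irreducible polynomial and $t$ is a positive integer. Assume that the Smith form of $F$ is $\mathrm{diag}(p^{s_1},\dots,p^{s_l})$ with $s_1 \le \cdots \le s_l$. Then the following are equivalent: (1) $F$ is equivalent to its Smith form $\mathrm{diag}(p^{s_1},\dots,p^{s_l})$; (2) $J_i(F) = A$ for $i = 1,\dots,l$.
   Context: $A^{l\times m}$ is the set of $l\times m$ matrices over $A$, and $\mathrm{GL}_l(A)$ is the group of $l \times l$ unimodular (invertible) matrices over $A$. Two matrices $F,G\in A^{l\times m}$ are equivalent if $F = UGV$ for some $U\in \mathrm{GL}_l(A)$, $V\in\mathrm{GL}_m(A)$. For a matrix $F$ over $A$ of rank $r>0$ and $1\le i\le r$, $d_i(F)$ is the greatest common divisor of all $i\times i$ minors of $F$ (defined up to a unit of $A$), and $d_0(F)=1$. If $a_1,\dots,a_\beta$ are all the $i\times i$ minors of $F$ and $a_j = d_i(F)\, b_j$, then $J_i(F)$ is the ideal of $A$ generated by $b_1,\dots,b_\beta$ (the reduced $i \times i$ minors). The Smith form of a square matrix $F\in A^{l\times l}$ with $\det F\ne 0$ is $\mathrm{diag}(\Phi_1,\dots,\Phi_l)$ with $\Phi_i = d_i(F)/d_{i-1}(F)$; thus the assumption on the Smith form says that $d_i(F) = p^{s_1+\cdots+s_i}$ (up to a unit) for $i=1,\dots,l$. *)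

(* Defs.v *)
From HB Require Import structures.
From mathcomp Require Import all_boot all_order all_algebra.
From mathcomp Require Import mpoly.

Set Implicit Arguments.
Unset Strict Implicit.
Unset Printing Implicit Defensive.

Import GRing.Theory.
Local Open Scope ring_scope.

Section Ring.
Variable A : idomainType.

Definition rdivides (d a : A) : Prop := exists c : A, a = c * d.

Definition is_gcd (S : A -> Prop) (d : A) : Prop :=
  (forall a, S a -> rdivides d a) /\
  (forall e, (forall a, S a -> rdivides e a) -> rdivides e d).

Definition ideal_gen (S : A -> Prop) (x : A) : Prop :=
  exists (k : nat) (b c : 'I_k -> A),
    (forall j, S (b j)) /\ x = \sum_(j < k) c j * b j.

Definition is_minor (l m : nat) (F : 'M[A]_(l, m)) (i : nat) (a : A) : Prop :=
  exists (f : 'I_i -> 'I_l) (g : 'I_i -> 'I_m),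
    [/\ {homo f : j k / (j < k)%N},
        {homo g : j k / (j < k)%N}
      & a = \det (mxsub f g F)].

(* d_i(F), which is only defined up to a unit, is represented by the relation
   "d is a gcd of the i x i minors of F".  For i = 0 the only minor is 1. *)
Definition is_d (l m : nat) (F : 'M[A]_(l, m)) (i : nat) (d : A) : Prop :=
  is_gcd (is_minor F i) d.

(* Changing the gcd d multiplies all the reduced minors by a common unit, so
   letting d range over all the gcds does not change the ideal [J F i].
   Meaningful only for i at most the rank of F, when d <> 0 and b is determined
   by d and the minor. *)
Definition is_reduced_minor (l m : nat) (F : 'M[A]_(l, m)) (i : nat) (b : A)
  : Prop :=
  exists d a : A, [/\ is_d F i d, is_minor F i a & a = d * b].

Definition J (l m : nat) (F : 'M[A]_(l, m)) (i : nat) : A -> Prop :=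
  ideal_gen (is_reduced_minor F i).

Definition mx_equiv (l m : nat) (F G : 'M[A]_(l, m)) : Prop :=
  exists (U : 'M[A]_l) (V : 'M[A]_m),
    [/\ U \in unitmx, V \in unitmx & F = U *m G *m V].

(* The 0-based diagonal entry S i i is Phi_(i+1) = d_(i+1)(F) / d_i(F); the
   quotient is well defined because no d_i(F) vanishes when det F <> 0.  The
   d_i(F) being defined up to units, so is the Smith form. *)
Definition is_smith_form (l : nat) (F S : 'M[A]_l) : Prop :=
  [/\ \det F != 0, is_diag_mx S &
      exists d : nat -> A,
        [/\ d 0%N = 1,
            forall i, (1 <= i <= l)%N -> is_d F i (d i)
          & forall i : 'I_l, d i.+1 = S i i * d i]].

End Ring.

(* The inclusion of K[x_1] in K[x_1, ..., x_(n+1)]; x_1 is 'X_ord0. *)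
Definition in_x1 (K : fieldType) (n : nat) (p : {poly K}) : {mpoly K[n.+1]} :=
  horner_alg ('X_ord0 : {mpoly K[n.+1]}) p.

(* Main.v *)
(** Both directions rest on the fact that (2) says that the i x i minors of F
    generate the ideal of p^(s_1 + ... + s_i): this ideal is invariant under
    equivalence, which gives (1) => (2).

    Conversely, dividing F by p^(s_1) one may assume s_1 = 0.  Modulo p, F then has
    constant rank r >= 1: its r x r minors generate the unit ideal and the larger
    ones vanish, so F mod p has a generalized inverse and its image is projective
    over L[x_2, ..., x_n], where L = K[x_1] / (p).  By the theorem of Quillen and
    Suslin this image is free, so some column v mod p has a unimodular image.  A
    unimodular column mod p is the reduction of the first column of a matrix in SL
    (column_lift_iter), so F can be replaced by F H whose first column c is
    unimodular mod p; as the ideal of the entries of c contains a power of p, c is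
    unimodular, and completing c to an invertible matrix splits off a diagonal
    entry 1.  Induction on l concludes.

    Columns are treated by the method of Suslin and Vaserstein: after a change of
    variables an entry is monic in the last variable x; the b such that c (g + b h)
    and c (g) are equivalent for all g and h form an ideal, and outside of every
    maximal ideal this ideal contains the resultant of two entries.

    That a projective P over S[x] is free is deduced from the same statement over
    S and from the theorem on columns.  For a free module M and a monic f with
    f P <= M <= P, the quotient P / M is a finite projective, hence free S-module
    S^N.  Comparing P -> P / M with the resolution of P / M by x - T on S[x]^N,
    where T is the multiplication by x, shows that P is stably free. *)

Require Import Defs.
From HB Require Import structures.
From mathcomp Require Import all_boot all_order all_algebra.
From mathcomp Require Import fingroup perm ring_quotient generic_quotient ring.
From mathcomp Require Import mpoly.
From mathcomp Require boolp classical_sets.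

Set Implicit Arguments.
Unset Strict Implicit.
Unset Printing Implicit Defensive.

Import GRing.Theory.
Local Open Scope ring_scope.

(** * Residue fields *)

(** Membership is valued in [Prop]: the ideals met below are given by the existence of matrices,
    with no boolean test at hand. *)
Definition is_ideal (B : comNzRingType) (J : B -> Prop) : Prop :=
  J 0 /\ forall a u v, J u -> J v -> J (a * u + v).

Section Maximal.
Variables (B : comNzRingType) (J : B -> Prop).
Hypotheses (idJ : is_ideal J) (J1 : ~ J 1).

Definition properly_contains (S : B -> Prop) : Prop :=
  [/\ is_ideal S, ~ S 1 & forall x, J x -> S x].

Lemma maximal_ideal_exists : exists M : B -> Prop,
  properly_contains M /\ forall x, ~ M x -> exists a, M (a * x - 1).
Proof.
(* The empty set is admitted because [P] must hold for the union of the empty chain. *)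
pose P (S : B -> Prop) : Prop := properly_contains S \/ forall x, ~ S x.
have [|M [PM maxM]] := @classical_sets.Zorn_bigcup B P.
  move=> F FP Ftot.
  have [[S0 FS0 [x0 S0x0]]|noS] :=
      boolp.pselect (exists2 S, F S & exists x, S x); last first.
    by right=> x [S FS Sx]; apply: noS; exists S => //; exists x.
  have [[idS0 S01 JS0]|] := FP _ FS0; last by move/(_ x0)/(_ S0x0).
  left; split=> [||x Jx]; last by exists S0 => //; exact: JS0.
    split=> [|a u v [S FS Su] [T FT Tv]]; first by exists S0 => //; case: idS0.
    have [sub|sub] := Ftot _ _ FS FT.
      have [[[_ idT] _ _]|] := FP _ FT; last by move/(_ v)/(_ Tv).
      by exists T => //; apply: idT => //; exact: sub.
    have [[[_ idS] _ _]|] := FP _ FS; last by move/(_ u)/(_ Su).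
    by exists S => //; apply: idS => //; exact: sub.
  move=> [S FS S1].
  by have [[_ nS1 _]|/(_ 1)] := FP _ FS.
have pM : properly_contains M.
  case: PM => // M0; have := maxM J; case.
    by split=> [x /M0 //|sub]; exact: (M0 0 (sub 0 idJ.1)).
  by left; split.
exists M; split=> // x nMx; apply: boolp.contrapT => noa.
have [[M0 idM] M1 JM] := pM.
(* [N] is generated by [M] and [x]. It is proper, since [1 = a x + u] with [u] in [M] would put
   [a x - 1] in [M]; this contradicts maximality. *)
pose N (y : B) := exists a u, M u /\ y = a * x + u.
have MN y : M y -> N y by move=> My; exists 0, y; rewrite mul0r add0r.
apply: (maxM N); first split=> [y /MN //|sub].
  by apply: nMx; apply: sub; exists 1, 0; rewrite mul1r addr0.
left; split=> [||y /JM/MN //].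
  split=> [|c _ _ [a [u [Mu ->]]] [b [v [Mv ->]]]]; first exact: MN.
  exists (c * a + b), (c * u + v); split; first exact: idM.
  by rewrite mulrDr mulrDl mulrA addrACA.
move=> [a [u [Mu a1]]]; apply: noa; exists a.
have -> : a * x - 1 = (-1) * u + 0 by rewrite mulN1r addr0 a1 opprD addNKr.
exact: idM.
Qed.

End Maximal.

Lemma residue_field (B : comNzRingType) (J : B -> Prop) :
    is_ideal J -> ~ J 1 ->
  exists (k : fieldType) (phi : {rmorphism B -> k}),
    (forall x, exists y, phi y = x) /\ (forall x, J x -> phi x = 0).
Proof.
move=> idJ J1; have [M [[idM M1 JM] maxM]] := maximal_ideal_exists idJ J1.
pose I : {pred B} := fun x => boolp.asbool (M x).
have IP x : reflect (M x) (x \in I) by exact: boolp.asboolP.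
have idI : idealr_closed I.
  split=> [||a u v /IP Mu /IP Mv]; [exact/IP/idM.1|exact/IP|exact/IP/idM.2].
pose I' : idealr B := HB.pack I (isIdealr.Build B I idI).
pose Q : comNzRingType := {ideal_quot I'}.
have piE0 (x : B) : (\pi_(Q)%qT x == 0) = (x \in I).
  by rewrite -[0](rmorph0 \pi_{ideal_quot I'}%qT) -Quotient.idealrBE subr0.
(* The condition [x != 0] sits under the existential so that choice yields a total function; its
   value at [0] is then reset to [0], as a field structure demands. *)
have invQ (x : Q) : exists y : Q, x != 0 -> y * x = 1.
  have [->|nz] := eqVneq x 0; first by exists 0.
  have [|a Ma] := maxM (repr x).
    by move/IP; rewrite -piE0 reprK (negPf nz).
  exists (\pi_(Q)%qT a) => _.
  rewrite -[x]reprK -rmorphM; apply/eqP.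
  by rewrite -[1](rmorph1 \pi_{ideal_quot I'}%qT) -Quotient.idealrBE; apply/IP.
have [inv invP] := boolp.choice invQ.
pose inv0 x := if x == 0 then 0 else inv x.
have mulV (x : Q) : x != 0 -> inv0 x * x = 1.
  by move=> nz; rewrite /inv0 (negPf nz) invP.
have inv00 : inv0 0 = 0 by rewrite /inv0 eqxx.
pose k : fieldType := HB.pack (Equality.sort Q) (GRing.ComNzRing.on Q)
  (GRing.ComNzRing_isField.Build Q mulV inv00).
pose phi : {rmorphism B -> k} := GRing.RMorphism.clone _ _ (\pi_{ideal_quot I'}%qT : B -> k) _.
exists k, phi; split=> [x|x Jx].
  by exists (repr (x : Q)); exact: (reprK (x : Q)).
by apply/eqP; rewrite [_ == _]piE0; apply/IP/JM.
Qed.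

(** * Unimodular columns *)

Lemma col_mx11A (R : Type) m (x y : 'cV[R]_1) (z : 'cV[R]_m) :
  (col_mx x (col_mx y z) : 'cV_(1 + (1 + m))) = (col_mx (col_mx x y) z : 'cV_(1 + 1 + m)).
Proof.
rewrite col_mxA; apply/matrixP=> i j; rewrite castmxE.
by congr (col_mx _ _ _ _); apply/val_inj.
Qed.

Lemma col_mx_delta (R : nzRingType) m (a : R) :
  (col_mx a%:M 0 : 'cV_(1 + m)) = a *: delta_mx 0 0.
Proof.
apply/matrixP=> i j; rewrite !mxE ord1.
case: splitP => [i' /= ei|i' /= ei]; rewrite !mxE.
  by rewrite ord1 (_ : i == 0) ?eqxx ?mulr1 //; apply/eqP/val_inj; rewrite /= ei ord1.
by rewrite (_ : i == 0 = false) ?mulr0 //; apply/eqP=> i0; move: ei; rewrite i0.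
Qed.

(* The matrix [H] lives over [A], so that equivalent columns over the quotient
   [Ab] of [A] differ by a matrix that lifts to [SL(A)]. *)
Definition sl_equiv (A Ab : comNzRingType) (pi : {rmorphism A -> Ab}) m
    (c c' : 'cV[Ab]_m) : Prop :=
  exists H : 'M[A]_m, \det H = 1 /\ map_mx pi H *m c = c'.

Section SL.
Variables (A Ab : comNzRingType) (pi : {rmorphism A -> Ab}).
Local Notation "c ~~ c'" := (sl_equiv pi c c') (at level 70).

Lemma sl_equiv_refl m (c : 'cV_m) : c ~~ c.
Proof. by exists 1%:M; rewrite det1 map_mx1 mul1mx. Qed.

Lemma sl_equiv_trans m (c2 c1 c3 : 'cV_m) : c1 ~~ c2 -> c2 ~~ c3 -> c1 ~~ c3.
Proof.
move=> [H [dH <-]] [G [dG <-]]; exists (G *m H).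
by rewrite det_mulmx dG dH mulr1 map_mxM mulmxA.
Qed.

Lemma sl_equiv_sym m (c1 c2 : 'cV_m) : c1 ~~ c2 -> c2 ~~ c1.
Proof.
move=> [H [dH <-]]; exists (\adj H); split.
  by have := congr1 determinant (mul_mx_adj H); rewrite det_mulmx dH mul1r det1.
by rewrite mulmxA -map_mxM mul_adj_mx dH map_mx1 mul1mx.
Qed.

Lemma sl_equiv_scale m (a : Ab) (c1 c2 : 'cV_m) :
  c1 ~~ c2 -> a *: c1 ~~ a *: c2.
Proof. by move=> [H [dH <-]]; exists H; rewrite -scalemxAr. Qed.

Lemma sl_equiv_add_up m1 m2 (u : 'M[A]_(m1, m2)) (a : 'cV_m1) (b : 'cV_m2) :
  col_mx a b ~~ col_mx (a + map_mx pi u *m b) b.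
Proof.
exists (block_mx 1%:M u 0 1%:M); split; first by rewrite det_ublock !det1 mulr1.
by rewrite map_block_mx !map_mx1 map_mx0 mul_block_col !mul1mx mul0mx add0r.
Qed.

Lemma sl_equiv_add_down m1 m2 (u : 'M[A]_(m2, m1)) (a : 'cV_m1) (b : 'cV_m2) :
  col_mx a b ~~ col_mx a (b + map_mx pi u *m a).
Proof.
exists (block_mx 1%:M 0 u 1%:M); split; first by rewrite det_lblock !det1 mulr1.
by rewrite map_block_mx !map_mx1 map_mx0 mul_block_col !mul1mx mul0mx addr0 addrC.
Qed.

Lemma sl_equiv_up m1 m2 (a a' : 'cV_m1) (b : 'cV_m2) :
  a ~~ a' -> col_mx a b ~~ col_mx a' b.
Proof.
move=> [H [dH <-]]; exists (block_mx H 0 0 1%:M).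
rewrite det_ublock dH det1 mulr1 map_block_mx !map_mx0 map_mx1 mul_block_col.
by rewrite mul1mx !mul0mx addr0 add0r.
Qed.

Lemma sl_equiv_down m1 m2 (a : 'cV_m1) (b b' : 'cV_m2) :
  b ~~ b' -> col_mx a b ~~ col_mx a b'.
Proof.
move=> [H [dH <-]]; exists (block_mx 1%:M 0 0 H).
rewrite det_ublock dH det1 mulr1 map_block_mx !map_mx0 map_mx1 mul_block_col.
by rewrite mul1mx !mul0mx addr0 add0r.
Qed.

(** Three shears compose to a quarter turn; the sign keeps the determinant equal to 1. *)
Lemma sl_equiv_swap (a b : Ab) :
  (col_mx a%:M b%:M : 'cV_(1 + 1)) ~~ col_mx b%:M (- a)%:M.
Proof.
apply: sl_equiv_trans (sl_equiv_add_up 1%:M _ _) _.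
apply: sl_equiv_trans (sl_equiv_add_down (- 1%:M) _ _) _.
apply: sl_equiv_trans (sl_equiv_add_up 1%:M _ _) _.
rewrite !map_mxN !map_mx1 !mulNmx !mul1mx raddfN /=.
have -> : b%:M - (a%:M + b%:M) = - a%:M :> 'M_1 by rewrite addrC opprD subrK.
have -> : a%:M + b%:M - a%:M = b%:M :> 'M_1 by rewrite addrC addKr.
exact: sl_equiv_refl.
Qed.

(** The column is folded from the bottom: the tail is reduced to one entry, which is then merged
    with the head. *)
Lemma sl_reduce :
    (forall a b : Ab, exists d, (col_mx a%:M b%:M : 'cV_(1 + 1)) ~~ col_mx d%:M 0) ->
  forall m (c : 'cV[Ab]_(1 + m)), exists d, c ~~ col_mx d%:M 0.
Proof.
move=> red2; elim=> [|m IHm] c.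
  exists (usubmx c 0 0); rewrite -mx11_scalar.
  have -> : col_mx (usubmx c) 0 = c.
    by rewrite -[RHS]vsubmxK; congr col_mx; rewrite [RHS]flatmx0.
  exact: sl_equiv_refl.
rewrite -[c]vsubmxK; have [d /(sl_equiv_down (usubmx c)) cd] := IHm (dsubmx c).
have [e ce] := red2 (usubmx c 0 0) d; exists e; apply: sl_equiv_trans cd _.
rewrite col_mx11A {1}[usubmx c]mx11_scalar; apply: sl_equiv_trans (sl_equiv_up _ ce) _.
by rewrite -[in X in _ ~~ X](col_mx0 _ 1 m 1) col_mx11A; exact: sl_equiv_refl.
Qed.

End SL.

Lemma sl_equiv_map (A Ab : comNzRingType) (pi : {rmorphism A -> Ab}) m
    (c c' : 'cV[A]_m) :
  sl_equiv idfun c c' -> sl_equiv pi (map_mx pi c) (map_mx pi c').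
Proof.
by move=> [H [dH <-]]; exists H; rewrite -map_mxM map_mx_id.
Qed.

Lemma map_poly_surj (A Ab : nzRingType) (pi : {rmorphism A -> Ab}) :
  (forall x, exists y, pi y = x) -> forall p, exists q, map_poly pi q = p.
Proof.
move=> surj; elim/poly_ind => [|p c [q <-]]; first by exists 0; rewrite rmorph0.
by have [y <-] := surj c; exists (q * 'X + y%:P); rewrite rmorphD rmorphM /= map_polyX map_polyC.
Qed.

Lemma map_mx_surj (A Ab : nzRingType) (pi : A -> Ab) m n :
  (forall x, exists y, pi y = x) -> forall M : 'M_(m, n), exists N, map_mx pi N = M.
Proof.
move=> surj M; have [f fP] := boolp.choice surj.
by exists (map_mx f M); apply/matrixP=> i j; rewrite !mxE.
Qed.

(** Euclid's algorithm, with each quotient lifted to [A]. The sign of [sl_equiv_swap] is why the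
    recursion runs on [- (a %% b)]. *)
Lemma sl_equiv_poly2 (A : comNzRingType) (k : fieldType) (pi : {rmorphism A -> {poly k}}) :
    (forall x, exists y, pi y = x) ->
  forall a b : {poly k}, exists d, sl_equiv pi (col_mx a%:M b%:M : 'cV_(1 + 1)) (col_mx d%:M 0).
Proof.
move=> surj a b; have [n] := ubnP (size b); elim: n a b => // n IHn a b lt_b_n.
have [->|nz_b] := eqVneq b 0.
  by exists a; rewrite raddf0; exact: sl_equiv_refl.
have [q piq] := surj (- (a %/ b)).
have [|d eqd] := IHn b (- (a %% b)).
  by rewrite size_polyN; exact: leq_trans (ltn_modpN0 _ nz_b) lt_b_n.
exists d; apply: sl_equiv_trans (sl_equiv_add_up _ q%:M _ _) _.
rewrite map_scalar_mx /= piq -scalar_mxM -raddfD /= {1}(divp_eq a b) mulNr addrAC subrr add0r.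
exact: sl_equiv_trans (sl_equiv_swap _ _ _) _.
Qed.

(** A second coordinate serves as scratch space: [(u, 0)], [(u, 1)], [(1, 1)], [(1, 0)]. Shears lift
    to [A] even when [u] does not lift to a unit. *)
Lemma sl_equiv_unit (A : comNzRingType) (Ab : comUnitRingType)
    (pi : {rmorphism A -> Ab}) m (u : Ab) :
    (forall x, exists y, pi y = x) ->
  u \is a GRing.unit -> sl_equiv pi (u *: delta_mx 0 0 : 'cV_m.+2) (delta_mx 0 0).
Proof.
move=> surj Uu; have [v piv] := surj u^-1; have [w piw] := surj (1 - u).
have eq2 : sl_equiv pi (col_mx u%:M 0 : 'cV_(1 + 1)) (col_mx 1%:M 0).
  apply: sl_equiv_trans (sl_equiv_add_down _ v%:M _ _) _.
  rewrite map_scalar_mx /= piv -scalar_mxM mulVr // add0r.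
  apply: sl_equiv_trans (sl_equiv_add_up _ w%:M _ _) _.
  rewrite map_scalar_mx /= piw mulmx1 -raddfD /= addrCA subrr addr0.
  apply: sl_equiv_trans (sl_equiv_add_down _ (- 1%:M) _ _) _.
  by rewrite map_mxN map_mx1 mulmx1 subrr; exact: sl_equiv_refl.
have /(sl_equiv_up (0 : 'cV_m)) := eq2.
by rewrite -!col_mx11A !col_mx0 !col_mx_delta scale1r.
Qed.

Lemma sl_equiv_field (A : comNzRingType) (k : fieldType) (pi : {rmorphism A -> k})
    m (c : 'cV[k]_m.+2) :
    (forall x, exists y, pi y = x) -> c != 0 -> sl_equiv pi c (delta_mx 0 0).
Proof.
move=> surj nz_c; have [|d cd] := @sl_reduce _ _ pi _ m.+1 c.
  move=> a b; have [->|nz_b] := eqVneq b 0.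
    by exists a; rewrite raddf0; exact: sl_equiv_refl.
  have [q piq] := surj (- (a / b)).
  exists b; apply: sl_equiv_trans (sl_equiv_add_up _ q%:M _ _) _.
  rewrite map_scalar_mx /= piq -scalar_mxM -raddfD /= mulNr divfK // subrr.
  by apply: sl_equiv_trans (sl_equiv_swap _ _ _) _; rewrite oppr0 raddf0; exact: sl_equiv_refl.
have nz_d : d != 0.
  apply: contraNneq nz_c => d0; have [H [_ <-]] := sl_equiv_sym cd.
  by rewrite d0 raddf0 col_mx0 mulmx0.
by apply: sl_equiv_trans cd _; rewrite col_mx_delta; apply: sl_equiv_unit; rewrite ?unitfE.
Qed.

(** * Columns with a monic entry, by resultants *)

Lemma comp_poly_shift (B : comNzRingType) (p g h : {poly B}) (r : B) :
  exists d, p \Po (g + r%:P * h) = (p \Po g) + r%:P * d.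
Proof.
elim/poly_ind: p => [|p c [d IHp]]; first by exists 0; rewrite !comp_poly0 mulr0 addr0.
exists ((p \Po g) * h + d * (g + r%:P * h)).
by rewrite !comp_polyD !comp_polyM !comp_polyX !comp_polyC IHp; ring.
Qed.

(* The library's [map_resultant] is restricted to morphisms defined on polynomials. *)
Lemma map_resultant_rmorph (R R' : nzRingType) (f : {rmorphism R -> R'}) (p q : {poly R}) :
    f (lead_coef p) != 0 -> f (lead_coef q) != 0 ->
  f (resultant p q) = resultant (map_poly f p) (map_poly f q).
Proof.
move=> nz_fp nz_fq; rewrite /resultant /Sylvester_mx !size_map_poly_id0 //.
rewrite -det_map_mx /= map_col_mx; congr (\det (col_mx _ _));
  by apply: map_lin1_mx => v; rewrite map_poly_rV rmorphM /= map_rVpoly.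
Qed.

Lemma det_block_scalar (R : comNzRingType) (a b c d : R) :
  \det (block_mx a%:M b%:M c%:M d%:M : 'M_(1 + 1)) = a * d - b * c.
Proof.
rewrite (expand_det_row _ (lshift 1 0)) big_split_ord /= !big_ord_recl !big_ord0 /=.
rewrite block_mxEul block_mxEur /cofactor !det_mx11 !mxE /=.
have e1 : @lift (1 + 1) (lshift 1 0) (0 : 'I_1) = rshift 1 0 by exact/val_inj.
have e2 : @lift (1 + 1) (rshift 1 0) (0 : 'I_1) = lshift 1 0 by exact/val_inj.
rewrite -[ord0]/(0 : 'I_1) !e1 !e2 (unsplitK (inr _ 0) : split (rshift 1 0) = _).
by rewrite row_mxEl row_mxEr !mxE /= expr0 expr1 !mulr1n !addr0 mul1r mulN1r mulrN.
Qed.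

(* [M g] being the matrix [[c0, -v], [q, u]] evaluated at [g], of determinant [r],
   the matrix [M (g + r h) * M g ^-1] has polynomial entries. *)
Lemma sl_equiv_shift2 (B : idomainType) (c0 q u v g h : {poly B}) (r : B) :
    r != 0 -> r%:P = u * c0 + v * q ->
  let g' := g + r%:P * h in
  sl_equiv (idfun : {poly B} -> {poly B})
    (col_mx (c0 \Po g)%:M (q \Po g)%:M : 'cV_(1 + 1))
    (col_mx (c0 \Po g')%:M (q \Po g')%:M).
Proof.
move=> nz_r rE g'.
have [a c0E] := comp_poly_shift c0 g h r; have [b qE] := comp_poly_shift q g h r.
have [m uE] := comp_poly_shift u g h r; have [n vE] := comp_poly_shift v g h r.
have rg : (u \Po g) * (c0 \Po g) + (v \Po g) * (q \Po g) = r%:P.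
  by rewrite -!comp_polyM -comp_polyD -rE comp_polyC.
have rg' : (u \Po g') * (c0 \Po g') + (v \Po g') * (q \Po g') = r%:P.
  by rewrite -!comp_polyM -comp_polyD -rE comp_polyC.
rewrite /g' in rg' *; rewrite {}c0E {}qE {}uE {}vE in rg' *.
move: (c0 \Po g) (q \Po g) (u \Po g) (v \Po g) rg rg' => C Q U V rg rg'.
have nz_rP : r%:P != 0 :> {poly B} by rewrite polyC_eq0.
move: (r%:P) nz_rP rg rg' => R nz_R rg rg'.
exists (block_mx (1 + a * U + n * Q)%:M (a * V - n * C)%:M
                 (b * U - m * Q)%:M (1 + b * V + m * C)%:M); split.
  (* The two expressions of [R], at [g] and at [g'], differ by [R] times this sum. *)
  have key : (a * U + n * Q + b * V + m * C) + R * (m * a + n * b) = 0.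
    apply: (mulfI nz_R); apply: (addrI R).
    by rewrite mulr0 addr0 -[RHS]rg' -{1}rg; ring.
  rewrite det_block_scalar -[RHS]addr0 -key -rg; ring.
rewrite map_mx_id // mul_block_col -!scalar_mxM -!raddfD /=.
by congr (col_mx _%:M _%:M); rewrite -rg; ring.
Qed.

Lemma sl_equiv_comp (B : comNzRingType) m (c c' : 'cV[{poly B}]_m) (g : {poly B}) :
    sl_equiv (idfun : {poly B} -> {poly B}) c c' ->
  sl_equiv (idfun : {poly B} -> {poly B})
    (map_mx (comp_poly g) c) (map_mx (comp_poly g) c').
Proof.
move=> [H [dH <-]]; exists (map_mx (comp_poly g) H).
rewrite (det_map_mx (comp_poly g)) dH rmorph1 !(map_mx_id (f := idfun)) //.
by rewrite (map_mxM (comp_poly g)).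
Qed.

Lemma map_comp_poly_shift (B : comNzRingType) m (D : 'cV[{poly B}]_m) (g h : {poly B}) (r : B) :
  exists d, map_mx (comp_poly (g + r%:P * h)) D = map_mx (comp_poly g) D + r%:P *: d.
Proof.
have [f fP] := boolp.choice (fun i => comp_poly_shift (D i 0) g h r).
by exists (\col_i f i); apply/matrixP=> i j; rewrite !mxE ord1 fP.
Qed.

(* Euclid's algorithm over [k], lifted to [B], turns [C1] into a column that is
   [(d, 0, ..., 0)] over [k] with [d] prime to [c0]; [r] is the resultant of [c0]
   and of the first entry of this column, made monic. *)
Lemma suslin_resultant (B : idomainType) (k : fieldType) (phi : {rmorphism B -> k}) m
    (c0 : {poly B}) (C1 : 'cV[{poly B}]_(1 + m)) (z : 'rV[{poly k}]_(1 + (1 + m))) :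
    (forall x, exists y, phi y = x) -> c0 \is monic ->
    z *m map_mx (map_poly phi) (col_mx c0%:M C1) = 1%:M ->
  exists r : B, phi r != 0 /\ forall g h : {poly B},
    sl_equiv (idfun : {poly B} -> {poly B})
      (map_mx (comp_poly g) (col_mx c0%:M C1))
      (map_mx (comp_poly (g + r%:P * h)) (col_mx c0%:M C1)).
Proof.
move=> surj mon_c0 zC.
have surjP := map_poly_surj surj.
have [d [E [dE E_C1]]] := sl_reduce (sl_equiv_poly2 surjP) (map_mx (map_poly phi) C1).
set D := dsubmx (E *m C1); set a := usubmx (E *m C1) 0 0.
have EC1 : E *m C1 = col_mx a%:M D by rewrite -mx11_scalar vsubmxK.
have {}E_C1 : map_mx (map_poly phi) (E *m C1) = col_mx d%:M 0 by rewrite (map_mxM (map_poly phi)).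
have phia : map_poly phi a = d.
  have := congr1 (fun M => usubmx M 0 0) E_C1.
  by rewrite EC1 map_col_mx !col_mxKu map_scalar_mx !mxE !mulr1n.
(* Adding a high multiple of the monic [c0] makes the entry monic and keeps its class modulo
   [c0]. *)
pose N := (size a).+1; pose q := a + c0 * 'X^N.
have nz_c0 := monic_neq0 mon_c0.
have lt_a : (size a < size (c0 * 'X^N)%R)%N by rewrite size_mulXn // leq_addr.
have mon_q : q \is monic by rewrite monicE lead_coefDr // lead_coef_Mmonic ?monicXn.
have size_q : (1 < size q)%N.
  rewrite /q addrC size_polyDl // size_mulXn // /N addSn ltnS addn_gt0 orbC.
  by rewrite lt0n size_poly_eq0 nz_c0.
have W : sl_equiv (idfun : {poly B} -> {poly B})
    (col_mx c0%:M C1) (col_mx (col_mx c0%:M q%:M) D).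
  apply: (@sl_equiv_trans _ _ _ _ (col_mx c0%:M (E *m C1))).
    by apply: sl_equiv_down; exists E; rewrite map_mx_id.
  rewrite EC1 col_mx11A; apply: (@sl_equiv_up _ _ _ (1 + 1) m).
  apply: sl_equiv_trans (sl_equiv_add_down _ ('X^N)%:M _ _) _.
  by rewrite map_mx_id // -scalar_mxM -raddfD /= [_ * c0]mulrC; exact: sl_equiv_refl.
have [r [u [v [rE phir]]]] : exists r u v, r%:P = u * c0 + v * q /\ phi r != 0.
  have [sz1|sz1] := leqP (size c0) 1.
    exists 1, 1, 0; split; last by rewrite rmorph1 oner_neq0.
    rewrite mul0r addr0 mul1r; move: mon_c0.
    by rewrite (size1_polyC sz1) monicE lead_coefC => /eqP ->.
  have [[u v] /= _ rE] := resultant_in_ideal sz1 size_q.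
  exists (resultant c0 q), u, v; split=> //.
  rewrite map_resultant_rmorph ?(monicP mon_c0) ?(monicP mon_q) ?rmorph1 ?oner_neq0 //.
  rewrite resultant_eq0 -leqNgt.
  (* Over [k], a common divisor of [c0] and [q] divides [c0] and [d], hence every entry of a
     unimodular column, so it is a unit and the resultant does not vanish. *)
  set G := gcdp _ _.
  have dvdGc : G %| map_poly phi c0 by exact: dvdp_gcdl.
  have dvdGd : G %| d.
    rewrite -phia -(dvdp_addl (n := map_poly phi (c0 * 'X^N))).
      by rewrite -rmorphD /=; exact: dvdp_gcdr.
    by rewrite rmorphM dvdp_mulr.
  have C1E : map_mx (map_poly phi) C1 = d *: (map_mx (map_poly phi) (\adj E) *m delta_mx 0 0).
    rewrite scalemxAr -col_mx_delta -E_C1 -(map_mxM (map_poly phi)) mulmxA mul_adj_mx dE.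
    by rewrite mul1mx.
  move: zC; rewrite -[z]hsubmxK map_col_mx mul_row_col map_scalar_mx /= C1E.
  rewrite -scalemxAr mul_mx_scalar.
  move=> /matrixP/(_ 0 0); rewrite !mxE eqxx /= => one.
  have : G %| 1 by rewrite -[1]one dvdp_add // dvdp_mulr.
  by rewrite dvdp1 => /eqP ->.
have nz_r : r != 0 by apply: contraNneq phir => ->; rewrite rmorph0.
exists r; split=> // g h; set g' := g + _.
apply: sl_equiv_trans (sl_equiv_comp g W) _; apply/sl_equiv_sym.
apply: sl_equiv_trans (sl_equiv_comp g' W) _; apply/sl_equiv_sym.
rewrite -![(1 + (1 + m))%N]/(1 + 1 + m)%N !map_col_mx !map_scalar_mx /=.
have [d' D'] := map_comp_poly_shift D g h r.
rewrite D'; apply: (@sl_equiv_trans _ _ _ _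
  (col_mx (col_mx (c0 \Po g)%:M (q \Po g)%:M) (map_mx (comp_poly g) D + r%:P *: d'))); last first.
  by apply: (@sl_equiv_up _ _ _ (1 + 1) m); exact: (sl_equiv_shift2 _ _ nz_r rE).
(* As [r] is a combination of [c0 \Po g] and [q \Po g], a change of the tail by a multiple of [r] is
   a shear from the first two entries. *)
have -> : r%:P *: d' = row_mx ((u \Po g) *: d') ((v \Po g) *: d') *m
    col_mx (c0 \Po g)%:M (q \Po g)%:M.
  rewrite mul_row_col !mul_mx_scalar !scalerA -scalerDl; congr (_ *: _).
  rewrite -(comp_polyC r g) rE comp_polyD !comp_polyM.
  by rewrite [_ * (u \Po g)]mulrC [_ * (v \Po g)]mulrC.
by rewrite -[row_mx _ _](map_mx_id (f := idfun)) //; exact: sl_equiv_add_down.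
Qed.

Lemma lift_monic (B Bb : nzRingType) (pi : {rmorphism B -> Bb}) (p : {poly Bb}) :
    (forall x, exists y, pi y = x) -> p \is monic ->
  exists2 q, q \is monic & map_poly pi q = p.
Proof.
move=> surj mon_p; have [f fP] := boolp.choice surj.
pose n := (size p).-1; pose q := \poly_(i < n) f p`_i + 'X^n.
have szq : (size (\poly_(i < n) f (p`_i)%R) < size ('X^n : {poly B}))%N.
  by rewrite size_polyXn ltnS size_poly.
exists q; first by rewrite monicE lead_coefDr // lead_coefXn.
have sp : size p = n.+1 by rewrite prednK // lt0n size_poly_eq0 monic_neq0.
apply/polyP=> i; rewrite /q coef_map coefD coef_poly coefXn raddfD /=.
have [lt_in|lt_ni|->] := ltngtP i n.
- by rewrite fP rmorph0 addr0.
- by rewrite !rmorph0 addr0 nth_default // sp.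
- by rewrite rmorph0 rmorph1 add0r -(monicP mon_p) lead_coefE.
Qed.

Section Suslin.
Variables (B Bb : idomainType) (pi : {rmorphism B -> Bb}).
Hypothesis surj : forall x, exists y, pi y = x.

(** Local-global argument: if the ideal [J] of admissible shifts were proper, some residue field
    would kill [J] but not the resultant that lies in [J]. *)
Lemma suslin_column m (c0 : {poly Bb}) (c1 : 'cV[{poly Bb}]_(1 + m))
    (z : 'rV[{poly Bb}]_(1 + (1 + m))) :
    c0 \is monic -> z *m col_mx c0%:M c1 = 1%:M ->
  sl_equiv (map_poly pi) (col_mx c0%:M c1) (map_mx (comp_poly 0) (col_mx c0%:M c1)).
Proof.
move=> mon_c0 zc.
have surjP := map_poly_surj surj.
have [C0 mon_C0 C0c] := lift_monic surj mon_c0.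
have [C1 C1c] := map_mx_surj surjP c1.
have [Z Zz] := map_mx_surj surjP z.
pose C := col_mx C0%:M C1.
have CE : map_mx (map_poly pi) C = col_mx c0%:M c1.
  by rewrite map_col_mx map_scalar_mx /= C0c C1c.
pose ev g := map_mx (map_poly pi) (map_mx (comp_poly g) C).
pose J b := forall g h : {poly B}, sl_equiv (map_poly pi) (ev g) (ev (g + b%:P * h)).
have idJ : is_ideal J.
  split=> [g h|a u v Ju Jv g h].
    by rewrite mul0r addr0; exact: sl_equiv_refl.
  apply: sl_equiv_trans (Ju g (a%:P * h)) _.
  have -> : g + (a * u + v)%:P * h = g + u%:P * (a%:P * h) + v%:P * h.
    by rewrite polyCD polyCM; ring.
  exact: Jv.
have J1 : J 1.
  apply: boolp.contrapT => nJ1.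
  have [k [phi [surj_phi phiJ]]] := residue_field idJ nJ1.
  (* The kernel of [pi] lies in [J], so an identity that holds over [Bb] only, such as
     unimodularity, still holds over the residue field. *)
  have ker_pi b : pi b = 0 -> phi b = 0.
    move=> pib; apply: phiJ => g h; rewrite (_ : ev _ = ev g); first exact: sl_equiv_refl.
    have evE g' : ev g' = map_mx (comp_poly (map_poly pi g')) (map_mx (map_poly pi) C).
      by apply/matrixP=> i j; rewrite ![fun_of_matrix (map_mx _ _) _ _]mxE map_comp_poly.
    by rewrite !evE rmorphD rmorphM /= map_polyC /= pib polyC0 mul0r addr0.
  have unimod : map_mx (map_poly phi) Z *m map_mx (map_poly phi) C = 1%:M.
    apply/eqP; rewrite -(map_mxM (map_poly phi)) -(map_mx1 (map_poly phi)) -subr_eq0.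
    rewrite -(map_mxB (map_poly phi)); apply/eqP/matrixP=> i j; rewrite mxE [RHS]mxE.
    apply/polyP=> n; rewrite coef_map coef0; apply: ker_pi.
    rewrite -coef_map (_ : map_poly pi _ = 0) ?coef0 //.
    have /matrixP/(_ i j) : map_mx (map_poly pi) (Z *m C - 1%:M) = 0.
      rewrite (map_mxB (map_poly pi)) (map_mxM (map_poly pi)) (map_mx1 (map_poly pi)).
      by rewrite Zz CE zc subrr.
    by rewrite mxE [RHS]mxE.
  have [r [phir rJ]] := suslin_resultant surj_phi mon_C0 unimod.
  by case/eqP: phir; apply: phiJ => g h; exact: (sl_equiv_map (map_poly pi) (rJ g h)).
(* Since [1] is in [J], the argument [X] may be shifted by [- X]. *)
have := J1 'X (- 'X); rewrite mul1r subrr.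
rewrite /ev; have -> : map_mx (comp_poly 'X) C = C.
  by apply/matrixP=> i j; rewrite mxE comp_polyXr.
have -> : map_mx (map_poly pi) (map_mx (comp_poly 0) C) =
    map_mx (comp_poly 0) (map_mx (map_poly pi) C).
  by apply/matrixP=> i j; rewrite ![fun_of_matrix (map_mx _ _) _ _]mxE map_comp_poly rmorph0.
by rewrite CE.
Qed.

End Suslin.

(* The last variable is the outermost one. *)
Fixpoint iter_poly (R : idomainType) (n : nat) : idomainType :=
  if n is m.+1 then {poly (iter_poly R m)} : idomainType else R.

Fixpoint iter_map (R S : idomainType) (f : {rmorphism R -> S}) (n : nat) :
    {rmorphism iter_poly R n -> iter_poly S n} :=
  if n is m.+1 return {rmorphism iter_poly R n -> iter_poly S n}
  then map_poly (iter_map f m) : {rmorphism {poly _} -> {poly _}} else f.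

Lemma iter_map_surj (R S : idomainType) (f : {rmorphism R -> S}) n :
  (forall x, exists y, f y = x) -> forall x, exists y, iter_map f n y = x.
Proof. by move=> surj; elim: n => //= n IHn; exact: map_poly_surj. Qed.

Lemma map_swapXY (R S : nzRingType) (f : {rmorphism R -> S}) (u : {poly {poly R}}) :
  map_poly (map_poly f) (swapXY u) = swapXY (map_poly (map_poly f) u).
Proof.
by apply/polyP=> i; apply/polyP=> j; rewrite (coef_map (map_poly f)) /= coef_map !coef_swapXY
  (coef_map (map_poly f)) coef_map.
Qed.

(** Since [e] exceeds the degrees in [X] of all coefficients, the top power of [y + X^e] dominates
    all the other terms in the degree in [X]. *)
Lemma lead_coef_swapXY_shift (R : idomainType) (g : {poly {poly R}}) (e : nat) :
    (forall i, size (g`_i)%R < e)%N -> g != 0 ->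
  lead_coef (swapXY (g \Po ('X + ('X^e)%:P))) = (lead_coef (lead_coef g))%:P.
Proof.
elim/poly_ind: g => [|g c IHg] ge nz_g; first by rewrite eqxx in nz_g.
have ge' i : (size (g`_i)%R < e)%N.
  by have := ge i.+1; rewrite coefD coefMX coefC /= addr0.
have ce : (size c < e)%N by have := ge 0%N; rewrite coefD coefMX coefC /= add0r.
rewrite comp_polyD comp_polyM comp_polyX comp_polyC rmorphD rmorphM /= swapXY_polyC.
have [g0|nz_g1] := eqVneq g 0.
  rewrite g0 comp_poly0 rmorph0 !mul0r !add0r lead_coefC lead_coef_map_inj ?rmorph0 //.
  exact: polyC_inj.
have qE : swapXY ('X + ('X^e)%:P) = ('X)%:P + 'X^e :> {poly {poly R}}.
  by rewrite rmorphD /= swapXY_X swapXY_polyC map_polyXn.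
have szX : (size ('X : {poly R})%:P < size ('X^e : {poly {poly R}}))%N.
  by rewrite size_polyXn ltnS (leq_trans (size_polyC_leq1 _)) // (leq_trans _ ce).
have mon_q : swapXY ('X + ('X^e)%:P) \is @monic {poly R}.
  by rewrite qE monicE lead_coefDr // lead_coefXn.
have IH := IHg ge' nz_g1; set G := swapXY (g \Po _) in IH *.
have nz_G : G != 0 by rewrite -lead_coef_eq0 IH polyC_eq0 !lead_coef_eq0.
rewrite lead_coefDl ?lead_coef_Mmonic // ?IH.
  rewrite lead_coefDl ?lead_coefMX // size_polyC size_mulX //.
  by case: (c != 0); rewrite // ltnS lt0n size_poly_eq0.
rewrite size_map_inj_poly ?polyC0 //; last exact: polyC_inj.
rewrite size_Mmonic // qE addrC size_polyDl // size_polyXn addnS /=.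
by rewrite (leq_trans ce) // leq_addl.
Qed.

(* The substitution [y := y + X^e], made after an automorphism that gives the
   leading coefficient in [y] a unit leading coefficient in [X].  The inverse [s']
   lifts to [S'] over [R]. *)
Lemma nagata (R : idomainType) (k : fieldType) (pi : {rmorphism R -> k}) n
    (f : {poly iter_poly k n}) :
    f != 0 ->
  exists (s s' : {rmorphism {poly iter_poly k n} -> {poly iter_poly k n}})
         (S' : {rmorphism {poly iter_poly R n} -> {poly iter_poly R n}}),
    [/\ lead_coef (s f) \is a GRing.unit, cancel s s'
      & forall x, map_poly (iter_map pi n) (S' x) = s' (map_poly (iter_map pi n) x)].
Proof.
elim: n f => [|n IHn] f nz_f.
  by exists idfun, idfun, idfun; rewrite /= unitfE lead_coef_eq0.
(* After the swap the last variable is the inner one, and the leading coefficient of [g] has one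
   variable less, as the induction hypothesis requires. *)
pose g := swapXY f.
have nz_g : g != 0 by rewrite swapXY_eq0.
have [|s [s' [S' [Us sK S's]]]] := IHn (lead_coef g); first by rewrite lead_coef_eq0.
pose g' := map_poly s g.
pose e := (\max_(i < size g') size (g'`_i)%R).+1.
pose q (T : idomainType) : {poly {poly T}} := 'X + ('X^e)%:P.
pose q' (T : idomainType) : {poly {poly T}} := 'X - ('X^e)%:P.
exists (swapXY \o (comp_poly (q _) \o (map_poly s \o swapXY))
  : {rmorphism {poly {poly _}} -> {poly {poly _}}}).
exists (swapXY \o (map_poly s' \o (comp_poly (q' _) \o swapXY))
  : {rmorphism {poly {poly _}} -> {poly {poly _}}}).
exists (swapXY \o (map_poly S' \o (comp_poly (q' _) \o swapXY))
  : {rmorphism {poly {poly _}} -> {poly {poly _}}}).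
split.
- have nz_g' : g' != 0.
    by rewrite -size_poly_eq0 size_map_inj_poly ?size_poly_eq0 ?rmorph0 //; exact: can_inj sK.
  have lc_g' : lead_coef g' = s (lead_coef g).
    by rewrite lead_coef_map_inj ?rmorph0 //; exact: can_inj sK.
  rewrite /= lead_coef_swapXY_shift // -/g' ?lc_g' ?rmorph_unit // => i.
  have [lt_ig|le_gi] := ltnP i (size g').
    by rewrite ltnS (leq_bigmax (Ordinal lt_ig)).
  by rewrite nth_default // size_poly0.
- move=> x /=; rewrite swapXYK -comp_polyA comp_polyD comp_polyX comp_polyC subrK comp_polyXr.
  by rewrite -map_poly_comp (eq_map_poly (g := idfun)) ?map_poly_id ?swapXYK.
- move=> x /=; rewrite map_swapXY; congr swapXY.
  have mapS y : map_poly (map_poly (iter_map pi n)) (map_poly S' y) =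
                map_poly s' (map_poly (map_poly (iter_map pi n)) y).
    by rewrite -!map_poly_comp; apply: eq_map_poly => z; exact: S's.
  rewrite mapS (map_comp_poly (map_poly (iter_map pi n))) map_swapXY; congr (map_poly _ (_ \Po _)).
  by rewrite /q' (rmorphB (map_poly _)) /= map_polyX map_polyC /= map_polyXn.
Qed.

(** For the identity this says that unimodular columns can be completed to matrices of determinant
    1. Length at least 2 is imposed because a single unit entry cannot be changed by a matrix of
    determinant 1. *)
Definition column_lift (A Ab : comNzRingType) (pi : {rmorphism A -> Ab}) : Prop :=
  forall m (c : 'cV[Ab]_m.+2) (z : 'rV[Ab]_m.+2),
    z *m c = 1%:M -> sl_equiv pi c (delta_mx 0 0).

Lemma unimodular_sl_equiv (A Ab : comNzRingType) (pi : {rmorphism A -> Ab}) m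
    (c c' : 'cV[Ab]_m) (z : 'rV[Ab]_m) :
  sl_equiv pi c c' -> z *m c = 1%:M -> exists z', z' *m c' = 1%:M.
Proof.
move/sl_equiv_sym => [H [_ <-]] zc.
by exists (z *m map_mx pi H); rewrite -mulmxA.
Qed.

Lemma sl_equiv_head_neq0 (A Ab : comNzRingType) (pi : {rmorphism A -> Ab}) m
    (c : 'cV[Ab]_(1 + m)) :
  c != 0 -> exists2 c' : 'cV[Ab]_(1 + m), sl_equiv pi c c' & usubmx c' 0 0 != 0.
Proof.
move=> nz_c; have [c00|nz_c0] := eqVneq (usubmx c 0 0) 0; last first.
  by exists c => //; exact: sl_equiv_refl.
have [c10|/matrix0Pn[j [i nz]]] := eqVneq (dsubmx c) 0.
  by case/eqP: nz_c; rewrite -[c]vsubmxK c10 [usubmx c]mx11_scalar c00 raddf0 col_mx0.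
exists (col_mx (usubmx c + map_mx pi (delta_mx 0 j) *m dsubmx c) (dsubmx c)).
  by rewrite -{1}[c]vsubmxK; exact: sl_equiv_add_up.
by rewrite col_mxKu mxE c00 add0r map_delta_mx -rowE mxE -(ord1 i).
Qed.

Lemma map_mx_comp_poly0 (R : comNzRingType) m n (M : 'M[{poly R}]_(m, n)) :
  map_mx (comp_poly 0) M = map_mx polyC (map_mx (horner_eval 0) M).
Proof. by apply/matrixP=> i j; rewrite !mxE comp_poly0r /horner_eval horner_coef0. Qed.

(** Induction on the number of variables: [nagata] makes the head monic up to a unit,
    [suslin_column] sets the last variable to 0, and the induction hypothesis handles the resulting
    column. *)
Lemma column_lift_iter (R : idomainType) (k : fieldType) (pi : {rmorphism R -> k}) n :
  (forall x, exists y, pi y = x) -> column_lift (iter_map pi n).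
Proof.
move=> surj; elim: n => [|n IHn] m c z zc.
  apply: sl_equiv_field => //; apply: contraTneq isT => c0.
  by move/matrixP/(_ 0 0)/eqP: zc; rewrite c0 mulmx0 !mxE eqxx eq_sym oner_eq0.
have nz_c : c != 0.
  apply: contraTneq isT => c0.
  by move/matrixP/(_ 0 0)/eqP: zc; rewrite c0 mulmx0 !mxE eqxx eq_sym oner_eq0.
have [c' cc' nz_c'] := @sl_equiv_head_neq0 _ _ (iter_map pi n.+1) m.+1 c nz_c.
apply: (sl_equiv_trans cc').
have [z' zc'] := unimodular_sl_equiv cc' zc.
move: c' z' {cc' z zc nz_c c} nz_c' zc' => c z nz_c zc.
have [s [s' [S' [Us sK S's]]]] := nagata pi nz_c.
set u := lead_coef _ in Us.
pose c1 : 'cV[{poly iter_poly k n}]_(1 + m.+1) := u^-1%:P *: map_mx s c.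
pose z1 : 'rV[{poly iter_poly k n}]_(1 + m.+1) := u%:P *: map_mx s z.
have zc1 : z1 *m c1 = 1%:M.
  rewrite -scalemxAl -scalemxAr scalerA -polyCM divrr // scale1r.
  by rewrite -(map_mxM s) zc map_mx1.
have mon_c1 : usubmx c1 0 0 \is monic.
  have -> : usubmx c1 0 0 = u^-1%:P * s (usubmx c 0 0) by rewrite !mxE.
  by rewrite monicE lead_coefM lead_coefC -/u mulVr.
have := zc1; rewrite -[c1]vsubmxK [usubmx c1]mx11_scalar.
have surjn := iter_map_surj (n := n) surj.
move/(suslin_column surjn mon_c1); rewrite -mx11_scalar vsubmxK => c1_0.
pose d := map_mx (horner_eval 0) c1.
have dE : map_mx (comp_poly 0) c1 = map_mx polyC d by exact: map_mx_comp_poly0.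
have zd : map_mx (horner_eval 0) z1 *m d = 1%:M.
  by rewrite -(map_mxM (horner_eval 0)) zc1 (map_mx1 (horner_eval 0)).
have [G [dG Gd]] := IHn m d _ zd.
have c1e : sl_equiv (map_poly (iter_map pi n)) c1 (delta_mx 0 0 : 'cV[{poly iter_poly k n}]_m.+2).
  apply: (sl_equiv_trans c1_0); exists (map_mx polyC G).
  rewrite (det_map_mx polyC) dG rmorph1; split=> //.
  rewrite dE -(map_delta_mx polyC) -Gd (map_mxM polyC); congr (_ *m _).
  by apply/matrixP=> i j; rewrite !mxE /= map_polyC.
(* The scaling that made the head monic is undone; it leaves [u] times the first basis vector. *)
have := sl_equiv_scale u%:P c1e; rewrite scalerA -polyCM divrr // scale1r => scu.
have Uu : u%:P \is a @GRing.unit {poly iter_poly k n} by exact: rmorph_unit.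
have [H [dH Hc]] := sl_equiv_trans scu (sl_equiv_unit _ (iter_map_surj (n := n.+1) surj) Uu).
(* The matrix [H] has its entries over [R], so the change of variables is undone on it by the lift
   [S'] of [s']. *)
exists (map_mx S' H); rewrite (det_map_mx S') dH rmorph1; split=> //.
have <- : map_mx s' (delta_mx 0 0) = delta_mx 0 0 :> 'cV[{poly iter_poly k n}]_m.+2.
  exact: map_delta_mx.
rewrite -Hc (map_mxM s'); congr (_ *m _); apply/matrixP=> i j.
  by rewrite !mxE; exact: S's.
by rewrite !mxE sK.
Qed.

(** * Projective modules over polynomial rings *)

(* A projective module is given as the image of an idempotent matrix. *)
Definition proj_free (A : comNzRingType) : Prop :=
  forall l (E : 'M[A]_l), E *m E = E ->
    exists r (W : 'M[A]_(l, r)) (Z : 'M[A]_(r, l)), W *m Z = E /\ Z *m W = 1%:M.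

(** The columns of [W] form a basis of the kernel of the surjection [K]. Its rows are split off one
    by one, each being unimodular; the rank [r.+1] keeps their length at least 2. *)
Lemma kernel_free (A : comNzRingType) N r n (K : 'M[A]_(N, n)) (T : 'M[A]_(n, N)) :
    column_lift (idfun : A -> A) -> n = (N + r.+1)%N -> K *m T = 1%:M ->
  exists (W : 'M[A]_(n, r.+1)) (Z : 'M[A]_(r.+1, n)) (Y : 'M[A]_(n, N)),
    [/\ Z *m W = 1%:M, K *m W = 0 & W *m Z + Y *m K = 1%:M].
Proof.
move=> colA; elim: N n K T => [|N IHN] n K T nE KT.
  rewrite nE in K T KT *; exists 1%:M, 1%:M, 0.
  by rewrite !mulmx1 mul0mx addr0 [K]flatmx0.
case: n => [|[|n]] in K T nE KT *; [by []|by case: nE; rewrite addnS|].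
have {}nE : n.+1 = (N + r.+1)%N by case: nE.
pose K' : 'M_(1 + N, 1 + n.+1) := K; pose T' : 'M_(1 + n.+1, 1 + N) := T.
have KT' : K' *m T' = 1%:M by [].
have [H [dH Hk0]] : sl_equiv (idfun : A -> A) ((usubmx K')^T : 'cV_n.+2) (delta_mx 0 0).
  apply: (colA _ _ (lsubmx T')^T); rewrite -trmx_mul.
  have := congr1 usubmx (congr1 lsubmx KT').
  rewrite -mulmx_lsub -mul_usub_mx => ->.
  by rewrite (@scalar_mx_block _ 1 N) block_mxEh row_mxKl col_mxKu tr_scalar_mx.
pose O : 'M_(1 + n.+1) := H^T; pose O' : 'M_(1 + n.+1) := (\adj H)^T.
have OO' : O *m O' = 1%:M by rewrite -trmx_mul mul_adj_mx dH trmx1.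
have O'O : O' *m O = 1%:M by rewrite -trmx_mul mul_mx_adj dH trmx1.
pose a : 'cV_N := lsubmx (dsubmx (K' *m O)); pose K1 : 'M_(N, n.+1) := rsubmx (dsubmx (K' *m O)).
have KO : K' *m O = block_mx 1%:M 0 a K1.
  rewrite -[LHS]vsubmxK -[dsubmx _]hsubmxK -/a -/K1 block_mxEv; congr col_mx.
  rewrite -mul_usub_mx -[LHS]trmxK trmx_mul trmxK -(map_mx_id (f := idfun) _ H) // Hk0.
  apply/matrixP=> i j; rewrite !mxE ord1 eqxx andbT.
  case: splitP => [j' /= ej|j' /= ej]; rewrite !mxE.
    by rewrite ord1 (_ : j == 0) ?eqxx //; apply/eqP/val_inj; rewrite /= ej ord1.
  by rewrite (_ : j == 0 = false) //; apply/eqP=> j0; move: ej; rewrite j0.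
have K1T : K1 *m drsubmx (O' *m T') = 1%:M.
  have : K' *m O *m (O' *m T') = 1%:M by rewrite mulmxA -(mulmxA K') OO' mulmx1.
  rewrite KO -[O' *m T' in LHS]submxK mulmx_block (@scalar_mx_block _ 1 N).
  move=> /eq_block_mx[_]; rewrite mul1mx mul0mx addr0 => ur0 _ <-.
  by rewrite ur0 mulmx0 add0r.
have [W1 [Z1 [Y1 [ZW KW WZ]]]] := IHN _ K1 _ nE K1T.
exists (O *m col_mx 0 W1), (row_mx 0 Z1 *m O'), (O *m block_mx 1%:M 0 (- Y1 *m a) Y1).
split.
- by rewrite mulmxA -(mulmxA _ O' O) O'O mulmx1 mul_row_col mul0mx add0r.
- by rewrite mulmxA -[K]/K' KO (@mul_block_col _ 1 N 1 n.+1) !mulmx0 mul0mx !add0r KW col_mx0.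
- rewrite mulmxA -(mulmxA O _ (row_mx _ _)).
  have -> : O *m block_mx 1%:M 0 (- Y1 *m a) Y1 *m K =
      O *m (block_mx 1%:M 0 (- Y1 *m a) Y1 *m (K' *m O)) *m O'.
    by rewrite !mulmxA -(mulmxA _ O O') OO' mulmx1.
  rewrite -mulmxDl -mulmxDr KO mul_col_row mulmx_block.
  rewrite add_block_mx (_ : block_mx _ _ _ _ = 1%:M) ?mulmx1 //.
  rewrite (@scalar_mx_block _ 1 n.+1); congr block_mx.
  - by rewrite !mul0mx addr0 add0r.
  - by rewrite !mul0mx !mulmx0 !addr0.
  - by rewrite mulmx0 mulNmx addNr addr0.
  - by rewrite mulmx0 add0r WZ.
Qed.

(** Division by the monic [X - T] leaves a constant remainder; the recursion on the degree is
    Horner's scheme. *)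
Lemma row_mx_div_charpoly (S : comNzRingType) N (T : 'M[S]_N) (z : 'rV[{poly S}]_N) :
  exists (q : 'rV[{poly S}]_N) (z0 : 'rV[S]_N), z = q *m char_poly_mx T + map_mx polyC z0.
Proof.
have [n] : exists n, forall j, (size (z 0 j)%R <= n)%N.
  by exists (\max_j size (z 0 j)%R) => j; exact: leq_bigmax.
elim: n z => [|n IHn] z sz.
  exists 0, 0; rewrite mul0mx map_mx0 addr0; apply/rowP=> j; rewrite mxE.
  by apply/eqP; rewrite -size_poly_leq0.
pose z1 : 'rV[{poly S}]_N := \row_j \poly_(i < n) (z 0 j)`_i.+1.
have [|q [z0 z1E]] := IHn z1; first by move=> j; rewrite mxE size_poly.
exists ('X *: q + map_mx polyC z0), (z0 *m T + \row_j (z 0 j)`_0).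
have zE : z = 'X *: z1 + map_mx polyC (\row_j (z 0 j)`_0).
  apply/rowP=> j; rewrite !mxE; apply/polyP=> i.
  rewrite coefD coefXM coefC coef_poly; case: i => [|i] /=; first by rewrite add0r.
  by rewrite addr0; case: ltnP => // le_ni; rewrite nth_default // (leq_trans (sz j)).
have -> : map_mx polyC (z0 *m T + \row_j (z 0 j)`_0) =
    map_mx polyC z0 *m map_mx polyC T + map_mx polyC (\row_j (z 0 j)`_0).
  rewrite -[X in _ = X + _](map_mxM polyC); exact: (map_mxD polyC).
rewrite {1}zE z1E scalerDr mulmxDl -scalemxAl -!addrA; congr (_ + _).
rewrite addrA; congr (_ + _).
by rewrite /char_poly_mx mulmxBr subrK mul_mx_scalar.
Qed.

(* The rows of [a] are a basis of a free submodule of the row space of [E] that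
   contains the multiples by [f] of this row space. *)
Section MonicSplit.
Variables (S : idomainType) (l r : nat) (f : {poly S}).
Variables (E : 'M[{poly S}]_l) (a : 'M[{poly S}]_(r, l)) (b : 'M[{poly S}]_(l, r)).
Hypotheses (mon_f : f \is monic) (EE : E *m E = E).
Hypotheses (ab : a *m b = f%:M) (ba : b *m a = f *: E).

Local Notation d := (size f).-1.

Let nz_f : f != 0. Proof. exact: monic_neq0. Qed.
Let Uf : lead_coef f \is a GRing.unit. Proof. by rewrite (monicP mon_f) unitr1. Qed.

Lemma split_aE : a *m E = a.
Proof.
have : f *: (a *m E) = f *: a by rewrite scalemxAr -ba mulmxA ab mul_scalar_mx.
by move/matrixP=> aE; apply/matrixP=> i j; apply: (mulfI nz_f); have := aE i j; rewrite !mxE.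
Qed.

(* An [S]-linear retraction of [y |-> y a] from the row space of [E] to [S[X]^r]. *)
Definition split_h (p : 'rV[{poly S}]_l) : 'rV[{poly S}]_r :=
  map_mx (fun x => x %/ f) (p *m b).

(** The [S]-linear projection onto the kernel of [split_h] along the row space of [a]. *)
Definition split_k (p : 'rV[{poly S}]_l) : 'rV[{poly S}]_l := p - split_h p *m a.

Lemma split_hD p q : split_h (p + q) = split_h p + split_h q.
Proof. by rewrite /split_h mulmxDl; apply/rowP=> j; rewrite !mxE Pdiv.IdomainUnit.divpD. Qed.

Lemma split_hZ (c : S) p : split_h (c%:P *: p) = c%:P *: split_h p.
Proof.
rewrite /split_h -scalemxAl; apply/rowP=> j; rewrite !mxE !mul_polyC.
by rewrite Pdiv.IdomainUnit.divpZl.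
Qed.

Lemma split_h_row y : split_h (y *m a) = y.
Proof.
rewrite /split_h -mulmxA ab mul_mx_scalar; apply/rowP=> j; rewrite !mxE mulrC.
by rewrite Pdiv.IdomainMonic.mulpK.
Qed.

Lemma split_h_scale p : split_h (f *: p) = p *m b.
Proof.
rewrite /split_h -scalemxAl; apply/rowP=> j; rewrite !mxE mulrC.
by rewrite Pdiv.IdomainMonic.mulpK.
Qed.

Lemma split_h0 : split_h 0 = 0.
Proof. by rewrite -[0 in LHS](mul0mx 1 a) split_h_row. Qed.

Lemma split_kD p q : split_k (p + q) = split_k p + split_k q.
Proof. by rewrite /split_k split_hD mulmxDl opprD addrACA. Qed.

Lemma split_kZ (c : S) p : split_k (c%:P *: p) = c%:P *: split_k p.
Proof. by rewrite /split_k split_hZ -scalemxAl scalerBr. Qed.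

Lemma split_hk p : split_h (split_k p) = 0.
Proof.
have : split_h (split_k p) + split_h (split_h p *m a) = split_h p.
  by rewrite -split_hD subrK.
by rewrite split_h_row => /eqP; rewrite -subr_eq0 addrK => /eqP.
Qed.

Lemma split_kE p : p *m E = p -> split_k p *m E = split_k p.
Proof. by move=> pE; rewrite mulmxBl pE -mulmxA split_aE. Qed.

Lemma split_k_scale p : split_k (f *: (p *m E)) = 0.
Proof.
by rewrite /split_k split_h_scale -mulmxA ba -scalemxAr -mulmxA EE subrr.
Qed.

(** Rows with entries of degree below [deg f] are coded as vectors of [S^(l * d)], so that
    [S]-linear maps on them become matrices over [S]. *)
Definition split_iota (v : 'rV[S]_(l * d)) : 'rV[{poly S}]_l :=
  \row_j rVpoly (row j (vec_mx v)).

Definition split_rem (p : 'rV[{poly S}]_l) : 'rV[S]_(l * d) :=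
  mxvec (\matrix_j poly_rV (p 0 j %% f)).

Lemma split_iota_rem p : split_iota (split_rem p) = p - f *: map_mx (fun x => x %/ f) p.
Proof.
apply/rowP=> j; rewrite !mxE mxvecK rowK poly_rV_K.
  by rewrite {2}(Pdiv.IdomainMonic.divp_eq mon_f (p 0 j)) mulrC addrC addKr.
by rewrite -ltnS prednK ?ltn_modp // lt0n size_poly_eq0.
Qed.

Lemma split_iotaD u v : split_iota (u + v) = split_iota u + split_iota v.
Proof.
apply/rowP=> j; rewrite [LHS]mxE [RHS]mxE.
by rewrite ![fun_of_matrix (split_iota _) _ _]mxE !linearD.
Qed.

Lemma split_iotaZ (c : S) v : split_iota (c *: v) = c%:P *: split_iota v.
Proof.
apply/rowP=> j; rewrite [LHS]mxE [RHS]mxE.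
by rewrite [fun_of_matrix (split_iota _) _ _]mxE !linearZ /= mul_polyC.
Qed.

Lemma split_remD p q : split_rem (p + q) = split_rem p + split_rem q.
Proof.
rewrite -linearD; congr mxvec; apply/row_matrixP=> j.
by rewrite linearD /= !rowK mxE Pdiv.IdomainUnit.modpD // linearD.
Qed.

Lemma split_remZ (c : S) p : split_rem (c%:P *: p) = c *: split_rem p.
Proof.
rewrite -linearZ; congr mxvec; apply/row_matrixP=> j.
by rewrite linearZ /= !rowK mxE mul_polyC Pdiv.IdomainUnit.modpZl // linearZ.
Qed.

(* In the row space of [E], the kernel of [split_h] is an [S]-complement of the row
   space of [a]; it is a free [S]-module, with basis the rows of the matrix [P] of the proof. *)
Lemma proj_free_monic :
    proj_free S -> column_lift (idfun : {poly S} -> {poly S}) ->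
  exists s (W : 'M[{poly S}]_(l, s)) (Z : 'M[{poly S}]_(s, l)), W *m Z = E /\ Z *m W = 1%:M.
Proof.
move=> freeS colS.
have lamD u v : split_k (split_iota (u + v) *m E) =
    split_k (split_iota u *m E) + split_k (split_iota v *m E).
  by rewrite split_iotaD mulmxDl split_kD.
have lamZ c v : split_k (split_iota (c *: v) *m E) = c%:P *: split_k (split_iota v *m E).
  by rewrite split_iotaZ -scalemxAl split_kZ.
(* [lam] maps [S^(l * d)] onto the part of the row space of [E] killed by [split_h], and [split_rem]
   is a section of it there. *)
pose lam v := split_k (split_iota v *m E).
have lam0 : lam 0 = 0 by rewrite -(scale0r 0) /lam lamZ polyC0 scale0r.
have lamE v : lam v *m E = lam v by apply: split_kE; rewrite -mulmxA EE.
have lam_rem p : p *m E = p -> lam (split_rem p) = split_k p.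
  move=> pE; rewrite /lam split_iota_rem mulmxBl pE -scalemxAl.
  set q := _ *m E; rewrite -[in RHS](subrK (f *: q) p) [RHS]split_kD.
  by rewrite split_k_scale addr0.
have k_id p : split_h p = 0 -> split_k p = p by move=> h0; rewrite /split_k h0 mul0mx subr0.
(* Hence [split_rem] after [lam] is idempotent over [S], with image isomorphic to this complement,
   and [proj_free S] applies. *)
have eps_linear : linear (fun v => split_rem (lam v)).
  by move=> c u v; rewrite /lam lamD lamZ split_remD split_remZ.
pose eps : {linear 'rV[S]_(l * d) -> 'rV[S]_(l * d)} :=
  HB.pack (fun v => split_rem (lam v)) (GRing.isLinear.Build _ _ _ _ _ eps_linear).
pose M := lin1_mx eps.
have ME v : v *m M = split_rem (lam v) by exact: (mul_rV_lin1 eps).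
have lamM v : lam (v *m M) = lam v.
  by rewrite ME lam_rem // k_id // split_hk.
have MM : M *m M = M.
  by apply/row_matrixP=> i; rewrite row_mul [row i M]rowE ME lamM -ME.
have [N [W [Z [WZ ZW]]]] := freeS _ M MM.
pose P := \matrix_(i < N) lam (row i Z).
pose cf p := split_rem p *m W.
have lamZP (c : 'rV[S]_N) : lam (c *m Z) = map_mx polyC c *m P.
  rewrite !mulmx_sum_row (big_morph lam lamD lam0); apply: eq_bigr => i _.
  by rewrite /lam lamZ mxE rowK.
have cfP p : p *m E = p -> split_k p = map_mx polyC (cf p) *m P.
  move=> pE; rewrite -lamZP -mulmxA WZ lamM lam_rem //.
have P_inj (c : 'rV[S]_N) : map_mx polyC c *m P = 0 -> c = 0.
  rewrite -lamZP => lam_c; have := ME (c *m Z).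
  rewrite lam_c -(scale0r 0) -polyC0 split_remZ scale0r -WZ mulmxA -(mulmxA c) ZW mulmx1.
  by move/(congr1 (fun v => v *m W)); rewrite -mulmxA ZW mulmx1 mul0mx.
have PE : P *m E = P by apply/row_matrixP=> i; rewrite row_mul rowK lamE.
have aE := split_aE.
(* [T] is the multiplication by [X] induced on the quotient by the row space of [a]; [H] records the
   component of [X P] along [a]. *)
pose T := \matrix_(i < N) cf ('X *: row i P).
pose H := \matrix_(i < N) split_h ('X *: row i P).
have XP : 'X *: P = map_mx polyC T *m P + H *m a.
  apply/row_matrixP=> i; rewrite linearZ linearD /= !row_mul -map_row !rowK -cfP.
    by rewrite subrK.
  by rewrite -scalemxAl lamE.
(* The rows of [G] generate the row space of [E], and [K] gives their relations: [K] and [G] form a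
   split exact sequence, with section [sg]. *)
pose K := row_mx (char_poly_mx T) (- H); pose G := col_mx P a.
have KG : K *m G = 0.
  rewrite mul_row_col mulmxBl mul_scalar_mx XP mulNmx.
  by rewrite [_ + H *m a]addrC addrK subrr.
pose C := \matrix_(i < l) cf (row i E); pose H0 := \matrix_(i < l) split_h (row i E).
pose sg := row_mx (map_mx polyC C) H0.
have sgG : sg *m G = E.
  apply/row_matrixP=> i; rewrite mul_row_col linearD /= !row_mul -map_row !rowK -cfP.
    by rewrite subrK.
  by rewrite -row_mul EE.
have GE : G *m E = G by rewrite mul_col_mx PE aE.
(* Modulo the rows of [K] the coefficient [z] becomes a constant [z0]; then [split_h] kills [z0 P]
   and isolates the coefficient of [a]. *)
have kerG (z : 'rV_N) (y : 'rV_r) : row_mx z y *m G = 0 -> exists q, row_mx z y = q *m K.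
  have [q [z0 ->]] := row_mx_div_charpoly T z.
  rewrite mul_row_col => zy0; exists q.
  have : map_mx polyC z0 *m P + (y + q *m H) *m a = 0.
    have e : q *m char_poly_mx T *m P = q *m H *m a.
      rewrite -!mulmxA; congr (_ *m _).
      by rewrite mulmxBl mul_scalar_mx XP addrAC subrr add0r.
    by rewrite -[RHS]zy0 !mulmxDl e -[RHS]addrA [LHS]addrA [LHS]addrC.
  move=> e0.
  have y0 : y + q *m H = 0.
    have := congr1 split_h e0; rewrite split_hD split_h_row split_h0 -lamZP /lam split_hk.
    by rewrite add0r.
  move: e0; rewrite y0 mul0mx addr0 => /P_inj ->.
  rewrite map_mx0 addr0 mul_mx_row mulmxN; congr row_mx.
  by apply/eqP; rewrite -addr_eq0 y0.
have [tau tauP] : exists tau, 1%:M - G *m sg = tau *m K.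
  have /boolp.choice[t tP] : forall i, exists q, row i (1%:M - G *m sg) = q *m K.
    move=> i; rewrite -[row _ _]hsubmxK; apply: kerG.
    by rewrite hsubmxK -row_mul mulmxBl mul1mx -mulmxA sgG GE subrr row0.
  by exists (\matrix_i t i); apply/row_matrixP=> i; rewrite row_mul rowK tP.
(* [K] can be cancelled on the right, because its block [X - T] has a monic determinant. *)
have Kt : K *m tau = 1%:M.
  have : (K *m tau - 1%:M) *m K = 0.
    by rewrite mulmxBl mul1mx -mulmxA -tauP mulmxBr mulmx1 mulmxA KG mul0mx subr0 subrr.
  rewrite /K mul_mx_row -[0]row_mx0 => /eq_row_mx[+ _] => e0.
  have := congr1 (fun M0 => M0 *m \adj (char_poly_mx T)) e0.
  rewrite mul0mx -mulmxA mul_mx_adj mul_mx_scalar => /matrixP e1.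
  apply/eqP; rewrite -subr_eq0; apply/eqP/matrixP=> i j.
  apply: (mulfI (monic_neq0 (char_poly_monic T))).
  by have := e1 i j; rewrite mxE => ->; rewrite !mxE mulr0.
(* [kernel_free] asks for a positive rank; in rank 0, [f E = b a = 0] forces [E = 0]. *)
have [r0|r_gt0] := posnP r.
  have E0 : E = 0.
    have : f *: E = 0 by rewrite -ba; move: a b; rewrite r0 => a0 b0; rewrite [a0]flatmx0 mulmx0.
    move/matrixP=> fE; apply/matrixP=> i j; apply: (mulfI nz_f).
    by have := fE i j; rewrite mxE => ->; rewrite mxE mulr0.
  exists 0%N, 0, 0; rewrite mul0mx mulmx0 E0; split=> //.
  by rewrite [1%:M]flatmx0.
have nE : (N + r = N + r.-1.+1)%N by rewrite prednK.
(* The row space of [E] is the cokernel of [K] on rows, and multiplication by [W1] identifies it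
   with a free module. *)
have [W1 [Z1 [Y1 [ZW1 KW1 WZ1]]]] := kernel_free colS nE Kt.
exists r.-1.+1, (sg *m W1), (Z1 *m G); split.
  have -> : sg *m W1 *m (Z1 *m G) = sg *m (W1 *m Z1) *m G by rewrite !mulmxA.
  have -> : W1 *m Z1 = 1%:M - Y1 *m K by rewrite -WZ1 addrK.
  by rewrite mulmxBr mulmx1 mulmxBl -!mulmxA KG !mulmx0 subr0.
have -> : Z1 *m G *m (sg *m W1) = Z1 *m (G *m sg) *m W1 by rewrite !mulmxA.
have -> : G *m sg = 1%:M - tau *m K by rewrite -tauP opprB addrC subrK.
by rewrite mulmxBr mulmx1 mulmxBl -!mulmxA KW1 !mulmx0 subr0.
Qed.

End MonicSplit.

(** * Clearing denominators over the fraction field *)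

Lemma fraction_numden (R : idomainType) (x : {fraction R}) :
  exists n d : R, d != 0 /\ x * tofrac d = tofrac n.
Proof.
exists (frac (repr x)).1, (frac (repr x)).2; split; first exact: denom_ratioP.
rewrite -[x in x * _]reprK /tofrac; unlock FracField.tofrac.
rewrite -[LHS]/(FracField.mul _ _) -FracField.pi_mul; apply/eqP.
rewrite FracField.equivf_def /FracField.equivf /FracField.mulf.
by rewrite !numden_Ratio ?mulr1 ?oner_neq0 ?denom_ratioP // mulrC.
Qed.

Lemma clear_denominators (R : idomainType) m n (M : 'M[{fraction R}]_(m, n)) :
  exists (d : R) (M0 : 'M[R]_(m, n)), d != 0 /\ map_mx (@tofrac R) M0 = tofrac d *: M.
Proof.
have /boolp.choice[nd ndP] : forall ij : 'I_m * 'I_n, exists nd : R * R,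
    nd.2 != 0 /\ M ij.1 ij.2 * tofrac nd.2 = tofrac nd.1.
  by move=> ij; have [a [d ad]] := fraction_numden (M ij.1 ij.2); exists (a, d).
exists (\prod_ij (nd ij).2).
exists (\matrix_(i, j) ((nd (i, j)).1 * \prod_(ij | ij != (i, j)) (nd ij).2)); split.
  by apply/prodf_neq0 => ij _; case: (ndP ij).
apply/matrixP=> i j; rewrite !mxE tofracM [in RHS](bigD1 (i, j)) //= tofracM.
by case: (ndP (i, j)) => _ /= <-; rewrite -mulrA mulrC.
Qed.

Lemma idempotent_field (F : fieldType) l (E : 'M[F]_l) :
    E *m E = E ->
  exists r (W : 'M[F]_(l, r)) (Z : 'M[F]_(r, l)), W *m Z = E /\ Z *m W = 1%:M.
Proof.
move=> EE; have := mulmx_base E; have := row_base_free E; have := col_base_full E.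
move: (col_base E) (row_base E) => W Z fullW freeZ WZ.
exists (\rank E), W, Z; split=> //; apply: (row_free_inj freeZ); apply: (row_full_inj fullW).
by rewrite /= mul1mx !mulmxA WZ -mulmxA WZ EE.
Qed.

(** Over the fraction field [E] factors through its rank; [f] is the product of the denominators of
    the two factors. *)
Lemma idempotent_split (R : idomainType) l (E : 'M[R]_l) :
    E *m E = E ->
  exists r (f : R) (a : 'M[R]_(r, l)) (b : 'M[R]_(l, r)),
    [/\ f != 0, a *m b = f%:M & b *m a = f *: E].
Proof.
move=> EE; pose t := @tofrac R.
have EEt : map_mx t E *m map_mx t E = map_mx t E by rewrite -(map_mxM t) EE.
have [r [W [Z [WZ ZW]]]] := idempotent_field EEt.
have [d1 [b [nz_d1 bW]]] := clear_denominators W.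
have [d2 [a [nz_d2 aZ]]] := clear_denominators Z.
have t_inj m n (M N : 'M[R]_(m, n)) : map_mx t M = map_mx t N -> M = N.
  move=> MN; apply/matrixP=> i j; apply/eqP; rewrite -tofrac_eq; apply/eqP.
  by have /matrixP/(_ i j) := MN; rewrite !mxE.
exists r, (d1 * d2), a, b; split; first exact: mulf_neq0.
  apply: t_inj; rewrite (map_mxM t) aZ bW -scalemxAl -scalemxAr ZW map_scalar_mx /=.
  by rewrite scalerA mulrC -tofracM scalemx1.
apply: t_inj; rewrite (map_mxM t) aZ bW -scalemxAl -scalemxAr WZ (map_mxZ t).
by rewrite scalerA -tofracM.
Qed.

Lemma column_lift_eq (A Ab : comNzRingType) (pi pi' : {rmorphism A -> Ab}) :
  pi =1 pi' -> column_lift pi -> column_lift pi'.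
Proof.
move=> e liftA m c z zc; have [H [dH <-]] := liftA m c z zc.
by exists H; split=> //; congr (_ *m _); apply/matrixP=> i j; rewrite !mxE e.
Qed.

Lemma column_lift_id (k : fieldType) n :
  column_lift (idfun : iter_poly k n -> iter_poly k n).
Proof.
have lift_n : column_lift (iter_map (idfun : k -> k) n).
  by apply: column_lift_iter => x; exists x.
apply: column_lift_eq lift_n; elim: n => //= n IHn p.
by rewrite (eq_map_poly IHn) map_poly_id.
Qed.

(** The theorem of Quillen and Suslin: a change of variables makes the denominator [f] monic up to a
    unit, and [proj_free_monic] descends to one variable less. *)
Lemma proj_free_iter (k : fieldType) n : proj_free (iter_poly k n).
Proof.
elim: n => [|n IHn] l E EE; first exact: idempotent_field.
have [r [f [a [b [nz_f ab ba]]]]] := idempotent_split EE.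
have [s [s' [_ [Us sK _]]]] := nagata (idfun : k -> k) nz_f.
set u := lead_coef _ in Us.
pose f1 : {poly iter_poly k n} := u^-1 *: s f.
have mon_f1 : f1 \is monic by rewrite monicE lead_coefZ -/u mulVr.
have EE1 : map_mx s E *m map_mx s E = map_mx s E by rewrite -(map_mxM s) EE.
have ab1 : (u^-1%:P *: map_mx s a) *m map_mx s b = f1%:M.
  by rewrite -scalemxAl -(map_mxM s) ab map_scalar_mx /= scale_scalar_mx /f1 mul_polyC.
have ba1 : map_mx s b *m (u^-1%:P *: map_mx s a) = f1 *: map_mx s E.
  by rewrite -scalemxAr -(map_mxM s) ba (map_mxZ s) scalerA /f1 mul_polyC.
have [q [W [Z [WZ ZW]]]] := proj_free_monic mon_f1 EE1 ab1 ba1 IHn (@column_lift_id k n.+1).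
exists q, (map_mx s' W), (map_mx s' Z); split; last by rewrite -(map_mxM s') ZW (map_mx1 s').
by rewrite -(map_mxM s') WZ; apply/matrixP=> i j; rewrite !mxE sK.
Qed.

(** * Ideals of minors *)

(* The ideal generated by the minors of size [i], described as the intersection of
   the ideals containing them; the index functions are arbitrary, which only adds
   [0] and changes of sign. *)
Definition minor_ideal (A : comNzRingType) l m (F : 'M[A]_(l, m)) i (x : A) : Prop :=
  forall I : A -> Prop, is_ideal I ->
    (forall (f : 'I_i -> 'I_l) (g : 'I_i -> 'I_m), I (\det (mxsub f g F))) -> I x.

Section IdealClosure.
Variables (A : comNzRingType) (I : A -> Prop).
Hypothesis idI : is_ideal I.

Lemma ideal0 : I 0. Proof. by case: idI. Qed.

Lemma idealM a x : I x -> I (a * x).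
Proof. by move=> Ix; rewrite -[_ * _]addr0; apply: idI.2 => //; exact: ideal0. Qed.

Lemma idealD x y : I x -> I y -> I (x + y).
Proof. by move=> Ix Iy; rewrite -[x]mul1r; exact: idI.2. Qed.

Lemma ideal_sum (T : finType) (P : pred T) (F : T -> A) :
  (forall t, P t -> I (F t)) -> I (\sum_(t | P t) F t).
Proof. by move=> IF; elim/big_ind: _ => //; [exact: ideal0|exact: idealD]. Qed.

End IdealClosure.

Lemma ideal_multiples (A : comNzRingType) (d : A) : is_ideal (fun x => exists c, x = c * d).
Proof.
split=> [|a _ _ [c1 ->] [c2 ->]]; first by exists 0; rewrite mul0r.
by exists (a * c1 + c2); rewrite mulrDl mulrA.
Qed.

(** Cauchy-Binet before grouping: the sum runs over all index functions, which is enough for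
    membership in an ideal. *)
Lemma det_mulmx_rect (A : comNzRingType) i l (M : 'M[A]_(i, l)) (N : 'M[A]_(l, i)) :
  \det (M *m N) = \sum_(h : {ffun 'I_i -> 'I_l}) (\prod_k M k (h k)) * \det (rowsub h N).
Proof.
rewrite /determinant.
under eq_bigr => s _ do
  (under eq_bigr => k _ do rewrite mxE; rewrite bigA_distr_bigA big_distrr /=).
rewrite exchange_big /=; apply: eq_bigr => h _.
rewrite big_distrr; apply: eq_bigr => s _ /=; rewrite mulrCA; congr (_ * _).
by rewrite -big_split /=; apply: eq_bigr => k _; rewrite mxE.
Qed.

Lemma minor_mull (A : comNzRingType) l m n (U : 'M[A]_(n, l)) (F : 'M[A]_(l, m)) i
    (I : A -> Prop) (f : 'I_i -> 'I_n) (g : 'I_i -> 'I_m) :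
    is_ideal I -> (forall (f : 'I_i -> 'I_l) (g : 'I_i -> 'I_m), I (\det (mxsub f g F))) ->
  I (\det (mxsub f g (U *m F))).
Proof.
move=> idI IF; rewrite mxsub_mul det_mulmx_rect; apply: ideal_sum => // h _; apply: idealM => //.
rewrite (_ : rowsub h _ = mxsub h g F) //.
by apply/matrixP=> a b; rewrite !mxE.
Qed.

Lemma minor_mulr (A : comNzRingType) l m n (F : 'M[A]_(l, m)) (V : 'M[A]_(m, n)) i
    (I : A -> Prop) (f : 'I_i -> 'I_l) (g : 'I_i -> 'I_n) :
    is_ideal I -> (forall (f : 'I_i -> 'I_l) (g : 'I_i -> 'I_m), I (\det (mxsub f g F))) ->
  I (\det (mxsub f g (F *m V))).
Proof.
move=> idI IF; rewrite -det_tr trmx_mxsub trmx_mul; apply: minor_mull => // f' g'.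
by rewrite -trmx_mxsub det_tr.
Qed.

Lemma sort_ord_fun i l (f : 'I_i -> 'I_l) : injective f ->
  exists (s : {perm 'I_i}) (f' : 'I_i -> 'I_l),
    {homo f' : j k / (j < k)%N} /\ forall k, f k = f' (s k).
Proof.
move=> inj_f.
have [rk [rk_lt rk_homo]] : exists rk : 'I_i -> nat, (forall k, (rk k < i)%N) /\
    (forall j k, (f j < f k)%N -> (rk j < rk k)%N).
  exists (fun k => #|[set j | (f j < f k)%N]|); split=> [k|j k lt_jk].
    rewrite -[i in (_ < i)%N]card_ord -cardsT; apply: proper_card.
    by apply/properP; split; [exact: subsetT|exists k; rewrite !inE ?ltnn].
  apply: proper_card; apply/properP; split.
    by apply/subsetP=> a; rewrite !inE => /ltn_trans; apply.
  by exists j; rewrite !inE ?ltnn.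
pose s0 k := Ordinal (rk_lt k).
have inj_s0 : injective s0.
  move=> j k [e]; apply: inj_f; apply/val_inj/eqP; rewrite eqn_leq.
  by apply/andP; split; rewrite leqNgt; apply/negP=> /rk_homo; rewrite e ltnn.
exists (perm inj_s0), (f \o (perm inj_s0)^-1%g); split=> [a b lt_ab|k /=]; last by rewrite permK.
move: lt_ab; rewrite -{1}(permKV (perm inj_s0) a) -{1}(permKV (perm inj_s0) b) /=.
move: (_ a) (_ b) => j k; rewrite !permE /= => lt_jk.
rewrite ltnNge leq_eqVlt; apply/negP=> /orP[/eqP/val_inj/inj_f e|/rk_homo].
  by rewrite e ltnn in lt_jk.
by rewrite ltnNge ltnW.
Qed.

Lemma minor_not_inj (A : comNzRingType) l m i (F : 'M[A]_(l, m))
    (f : 'I_i -> 'I_l) (g : 'I_i -> 'I_m) :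
  ~ injective f -> \det (mxsub f g F) = 0.
Proof.
move=> ninj; have [j [k [njk e]]] : exists j k, j != k /\ f j = f k.
  apply: boolp.contrapT => nex; apply: ninj => j k e; apply/eqP.
  by apply: contraT => njk; case: nex; exists j, k.
by apply: (determinant_alternate njk) => a; rewrite !mxE e.
Qed.

Lemma ideal_sorted_minors (A : idomainType) l m (F : 'M[A]_(l, m)) i (I : A -> Prop)
    (f : 'I_i -> 'I_l) (g : 'I_i -> 'I_m) :
  is_ideal I -> (forall a, is_minor F i a -> I a) -> I (\det (mxsub f g F)).
Proof.
move=> idI IF.
have [inj_f|/minor_not_inj->] := boolp.pselect (injective f); last exact: ideal0.
have [inj_g|ninj_g] := boolp.pselect (injective g); last first.
  by rewrite -det_tr trmx_mxsub minor_not_inj //; exact: ideal0.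
have [s [f' [hf fE]]] := sort_ord_fun inj_f; have [u [g' [hg gE]]] := sort_ord_fun inj_g.
have -> : mxsub f g F = row_perm s (col_perm u (mxsub f' g' F)).
  by apply/matrixP=> a b; rewrite !mxE fE gE.
rewrite row_permE col_permE !det_mulmx !det_perm [\det _ * _]mulrC; do 2![apply: idealM => //].
by apply: IF; exists f', g'; split.
Qed.

(** A Schur complement without division: multiplying by [C] makes the bordered matrix block
    triangular. *)
Lemma bordered_minor (A : idomainType) r (M : 'M[A]_r) (b : 'cV[A]_r) (c : 'rV[A]_r) (d : A) :
    \det M != 0 -> \det (block_mx d%:M c b M : 'M_(1 + r)) = 0 ->
  c *m \adj M *m b = (d * \det M)%:M.
Proof.
move=> nz_M B0; set B := block_mx _ _ _ _ in B0.
pose C : 'M_(1 + r) := block_mx (\det M)%:M 0 (- (\adj M *m b)) (\adj M).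
have BC : B *m C = block_mx ((d * \det M)%:M - c *m \adj M *m b) (c *m \adj M) 0 (\det M)%:M.
  rewrite mulmx_block !mulmxN -scalar_mxM mulmx0 add0r !mulmxA mul_mx_adj.
  by rewrite mul_mx_scalar mul_scalar_mx subrr mulmx0 add0r.
have : \det (B *m C) = 0 by rewrite det_mulmx B0 mul0r.
rewrite BC det_ublock det_scalar => /eqP; rewrite mulf_eq0 expf_eq0 (negPf nz_M) andbF orbF.
rewrite det_mx11 => /eqP e; rewrite [LHS]mx11_scalar; congr (_%:M).
move: e; rewrite mxE [X in X + _]mxE [X in _ + X]mxE mulr1n => /eqP.
by rewrite subr_eq0 => /eqP.
Qed.

(** The [x] such that [F G F = x F] for some [G] form an ideal. It contains each minor [\det M] of
    size [r], with [G] built from [\adj M], by the vanishing of the bordered minors. *)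
Lemma generalized_inverse (A : idomainType) l m r (F : 'M[A]_(l, m)) :
    minor_ideal F r 1 ->
    (forall (f : 'I_r.+1 -> 'I_l) (g : 'I_r.+1 -> 'I_m), \det (mxsub f g F) = 0) ->
  exists G : 'M[A]_(m, l), F *m G *m F = F.
Proof.
move=> F1 F0; pose I x := exists G : 'M[A]_(m, l), F *m G *m F = x *: F.
suff [G FGF] : I 1 by exists G; rewrite FGF scale1r.
apply: F1 => [|f g].
  split=> [|a x y [G Gx] [H Hy]]; first by exists 0; rewrite mulmx0 mul0mx scale0r.
  exists (a *: G + H); rewrite mulmxDr mulmxDl -scalemxAr -scalemxAl Gx Hy.
  by rewrite scalerA -scalerDl.
set M := mxsub f g F.
have [->|nz_M] := eqVneq (\det M) 0; first by exists 0; rewrite mulmx0 mul0mx scale0r.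
exists (colsub g 1%:M *m \adj M *m rowsub f 1%:M).
have -> : F *m (colsub g 1%:M *m \adj M *m rowsub f 1%:M) *m F =
    colsub g F *m \adj M *m rowsub f F.
  by rewrite !mulmxA mulmx_colsub mulmx1 -!mulmxA mul_rowsub_mx mul1mx.
apply/matrixP=> i j.
have -> : (colsub g F *m \adj M *m rowsub f F) i j =
    (row i (colsub g F) *m \adj M *m col j (rowsub f F)) 0 0.
  by rewrite -row_mul mxE [RHS]mxE; apply: eq_bigr => k _; congr (_ * _); rewrite [RHS]mxE.
rewrite (@bordered_minor _ _ _ _ _ (F i j)) //; first by rewrite !mxE mulr1n mulrC.
(* These indices border [M] by row [i] and column [j], possibly repeating one of its own; the
   vanishing hypothesis covers all index functions. *)
pose f1 (k : 'I_(1 + r)) := if split k is inr k' then f k' else i.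
pose g1 (k : 'I_(1 + r)) := if split k is inr k' then g k' else j.
rewrite -[RHS](F0 f1 g1); congr (\det _); apply/matrixP=> a b.
rewrite /block_mx mxE [RHS]mxE /f1 /g1.
by case: (split a) => a'; rewrite mxE; case: (split b) => b'; rewrite !mxE // !ord1 mulr1n.
Qed.

(** * Reduction to the Smith form *)

Section UnitBlock.
Variables (A : idomainType) (l : nat) (F : 'M[A]_l).
Let D : 'M[A]_(1 + l) := block_mx 1%:M 0 0 F.

Lemma minor_unit_block i (f g : 'I_i -> 'I_l) :
  exists f1 g1 : 'I_i.+1 -> 'I_(1 + l), \det (mxsub f g F) = \det (mxsub f1 g1 D).
Proof.
pose ext (h : 'I_i -> 'I_l) (k : 'I_(1 + i)) : 'I_(1 + l) :=
  if split k is inr k' then rshift 1 (h k') else lshift l 0.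
exists (ext f), (ext g).
have -> : mxsub (ext f) (ext g) D = block_mx 1%:M 0 0 (mxsub f g F) :> 'M_(1 + i).
  apply/matrixP=> a b; rewrite mxE /ext [RHS]mxE.
  case: (split a) => a'; rewrite [RHS]mxE; case: (split b) => b'.
  - by rewrite block_mxEul !ord1.
  - by rewrite block_mxEur !mxE.
  - by rewrite block_mxEdl !mxE.
  - by rewrite block_mxEdr !mxE.
by rewrite (@det_ublock _ 1 i) det1 mul1r.
Qed.

(** Without row 0, a minor of [D] either has a zero column, namely column 0, or is a minor of
    [F]. *)
Lemma minor_unit_block_avoid i (f g : 'I_i -> 'I_(1 + l)) (I : A -> Prop) :
    is_ideal I -> (forall f g : 'I_i -> 'I_l, I (\det (mxsub f g F))) ->
    (forall k, f k != 0) -> I (\det (mxsub f g D)).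
Proof.
move=> idI IF f_nz.
have [/existsP[k /eqP gk]|/existsPn g_nz] := boolP [exists k, g k == 0].
  rewrite (expand_det_col _ k) big1 => [|j _]; first exact: ideal0.
  rewrite mxE gk; have := f_nz j; case: (split_ordP (f j)) => j' ->.
    by rewrite ord1 => /eqP[]; apply/val_inj.
  have -> : (0 : 'I_(1 + l)) = lshift l 0 by apply/val_inj.
  by rewrite block_mxEdl mxE mul0r.
have lower (h : 'I_i -> 'I_(1 + l)) : (forall k, h k != 0) ->
    exists h' : 'I_i -> 'I_l, forall k, h k = rshift 1 (h' k).
  move=> h_nz; have /boolp.choice[h' h'E] : forall k, exists j, h k = rshift 1 j.
    move=> k; have := h_nz k; case: (split_ordP (h k)) => j' -> hk; last by exists j'.
    by case/eqP: hk; rewrite ord1; apply/val_inj.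
  by exists h'.
have [f' f'E] := lower f f_nz; have [g' g'E] := lower g g_nz.
have -> : mxsub f g D = mxsub f' g' F; last exact: IF.
by apply/matrixP=> a b; rewrite mxE [RHS]mxE f'E g'E /D block_mxEdr.
Qed.

Lemma minor_ideal_unit_block i x : minor_ideal D i.+1 x -> minor_ideal F i x.
Proof.
move=> Dx I idI IF; apply: Dx => // f g.
(* [k0] is a position sent to row 0 if there is one, and arbitrary otherwise; expanding along it
   leaves minors without row 0, a repeated row 0 being excluded first. *)
have [k0 k0P] : exists k0, forall k, k != k0 -> f k = 0 -> f k0 = 0.
  have [/existsP[k /eqP fk]|/existsPn f_nz] := boolP [exists k, f k == 0].
    by exists k.
  by exists ord0 => k _ fk; have := f_nz k; rewrite fk eqxx.
have [/existsP[k /andP[nk /eqP fk]]|/existsPn nhit] := boolP [exists k, (k != k0) && (f k == 0)].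
  rewrite minor_not_inj; first exact: ideal0.
  by move=> inj_f; move: (nk); rewrite (inj_f k k0) ?eqxx // fk (k0P k).
rewrite (expand_det_row _ k0); apply: ideal_sum => // j _.
apply: idealM => //; apply: idealM => //.
have -> : row' k0 (col' j (mxsub f g D)) = mxsub (f \o lift k0) (g \o lift j) D.
  by apply/matrixP=> a b; rewrite !mxE.
apply: minor_unit_block_avoid => // k; have := nhit (lift k0 k).
by rewrite negb_and negbK eq_sym (negPf (neq_lift _ _)).
Qed.

End UnitBlock.

(** * Equivalence of matrices and its effect on minors *)

Lemma mx_equiv_refl (A : idomainType) l m (F : 'M[A]_(l, m)) : mx_equiv F F.
Proof. by exists 1%:M, 1%:M; rewrite !unitmx1 mul1mx mulmx1. Qed.

Lemma mx_equiv_trans (A : idomainType) l m (G F H : 'M[A]_(l, m)) :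
  mx_equiv F G -> mx_equiv G H -> mx_equiv F H.
Proof.
move=> [U [V [uU uV ->]]] [U' [V' [uU' uV' ->]]].
by exists (U *m U'), (V' *m V); rewrite !unitmx_mul uU uV uU' uV' !mulmxA.
Qed.

Lemma mx_equiv_sym (A : idomainType) l m (F G : 'M[A]_(l, m)) :
  mx_equiv F G -> mx_equiv G F.
Proof.
move=> [U [V [uU uV ->]]]; exists (invmx U), (invmx V); rewrite !unitmx_inv uU uV.
by rewrite !mulmxA mulVmx // mul1mx mulmxK.
Qed.

Lemma mx_equiv_scale (A : idomainType) l m (F G : 'M[A]_(l, m)) (a : A) :
  mx_equiv F G -> mx_equiv (a *: F) (a *: G).
Proof.
by move=> [U [V [uU uV ->]]]; exists U, V; rewrite -scalemxAr -scalemxAl.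
Qed.

Lemma mx_equiv_block (A : idomainType) l (F G : 'M[A]_l) :
  mx_equiv F G ->
  mx_equiv (block_mx 1%:M 0 0 F : 'M_(1 + l)) (block_mx 1%:M 0 0 G).
Proof.
move=> [U [V [uU uV ->]]]; exists (block_mx 1%:M 0 0 U), (block_mx 1%:M 0 0 V).
rewrite !unitmxE !det_ublock !det1 !mul1r -!unitmxE uU uV; split=> //.
by rewrite !mulmx_block !mulmx0 !mul0mx !mul1mx !mulmx1 ?mul0mx ?addr0 ?add0r ?mulmx0 ?mul0mx.
Qed.

Lemma minor_ideal_mx_equiv (A : idomainType) l m (F G : 'M[A]_(l, m)) i x :
  mx_equiv F G -> minor_ideal F i x -> minor_ideal G i x.
Proof.
move=> [U [V [_ _ ->]]] Fx I idI IG; apply: Fx => // f g.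
by apply: minor_mulr => // f' g'; exact: minor_mull.
Qed.

Definition minors_dvd (A : idomainType) l m (F : 'M[A]_(l, m)) i (d : A) : Prop :=
  forall (f : 'I_i -> 'I_l) (g : 'I_i -> 'I_m), exists c, \det (mxsub f g F) = c * d.

Lemma minors_dvd_mx_equiv (A : idomainType) l m (F G : 'M[A]_(l, m)) i d :
  mx_equiv F G -> minors_dvd G i d -> minors_dvd F i d.
Proof.
move=> [U [V [_ _ ->]]] Gd f g; have idl := ideal_multiples d.
apply: (@minor_mulr _ _ _ _ _ _ _ (fun x => exists c, x = c * d)) => // f' g'.
exact: (@minor_mull _ _ _ _ _ _ _ (fun x => exists c, x = c * d)).
Qed.

Lemma minor_ideal1_neq0 (A : idomainType) l m (F : 'M[A]_(l, m)) :
  minor_ideal F 1 1 -> F != 0.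
Proof.
move=> F1; apply/eqP=> F0.
have /eqP : (1 : A) = 0; last by rewrite oner_eq0.
apply: (F1 (fun x => x = 0)) => [|f g].
  by split=> // a _ _ -> ->; rewrite mulr0 addr0.
by rewrite F0 mxsub_const det_mx11 mxE.
Qed.

Lemma minor_ideal_map (A Ab : comNzRingType) (pi : {rmorphism A -> Ab}) l m
    (F : 'M[A]_(l, m)) i x :
  minor_ideal F i x -> minor_ideal (map_mx pi F) i (pi x).
Proof.
move=> Fx I [I0 idI] IF; apply: (Fx (fun y => I (pi y))) => [|f g].
  by split=> [|a u v Iu Iv]; rewrite ?rmorph0 // rmorphD rmorphM; exact: idI.
by rewrite -det_map_mx map_mxsub.
Qed.

(** A truncated geometric series inverts [1 + p y] up to [(- p y)^k], which is a multiple of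
    [p^k]. *)
Lemma unimodular_of_power (A : comNzRingType) m (c : 'cV[A]_m) (z w : 'rV[A]_m) (p y : A) k :
  z *m c = (1 + p * y)%:M -> w *m c = (p ^+ k)%:M -> exists z', z' *m c = 1%:M.
Proof.
move=> zc wc.
exists ((\sum_(i < k) (- (p * y)) ^+ i) *: z + ((- y) ^+ k) *: w).
rewrite mulmxDl -!scalemxAl zc wc !scale_scalar_mx -raddfD /=; congr (_%:M).
have := subrXX 1 (- (p * y)) k; rewrite expr1n opprK.
have -> : \sum_(i < k) 1 ^+ (k.-1 - i) * (- (p * y)) ^+ i = \sum_(i < k) (- (p * y)) ^+ i.
  by apply: eq_bigr => i _; rewrite expr1n mul1r.
by move=> e; rewrite [_ * (1 + p * y)]mulrC -e -exprMn mulNr [y * p]mulrC subrK.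
Qed.

Definition partial_sum l (s : 'I_l -> nat) (i : nat) : nat := \sum_(j < l | (j < i)%N) s j.

Lemma partial_sum_const l (a i : nat) :
  (i <= l)%N -> partial_sum (fun _ : 'I_l => a) i = (i * a)%N.
Proof. by move=> le_il; rewrite /partial_sum (big_ord_narrow le_il) sum_nat_const card_ord. Qed.

Lemma partial_sum_sub l (s : 'I_l -> nat) (a i : nat) :
    (i <= l)%N -> (forall j, a <= s j)%N ->
  partial_sum s i = (i * a + partial_sum (fun j => s j - a) i)%N.
Proof.
move=> le_il le_as; rewrite -(partial_sum_const a le_il) /partial_sum -big_split /=.
by apply: eq_bigr => j _; rewrite subnKC.
Qed.

Lemma partial_sumS l (s : 'I_l.+1 -> nat) (i : nat) :
  partial_sum s i.+1 = (s ord0 + partial_sum (fun j => s (lift ord0 j)) i)%N.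
Proof. by rewrite /partial_sum big_mkcond big_ord_recl /= -big_mkcond. Qed.

Lemma diag_mx_unit_block (A : nzRingType) l (d : 'rV[A]_l.+1) :
  d 0 0 = 1 ->
  diag_mx d = block_mx 1%:M 0 0 (diag_mx (\row_j d 0 (lift ord0 j))) :> 'M_(1 + l).
Proof.
move=> d0; apply/matrixP=> i j.
case: (split_ordP i) => i' ->; case: (split_ordP j) => j' ->.
- rewrite block_mxEul !ord1 !mxE eqxx (_ : lshift l 0 = 0) ?d0 //; exact/val_inj.
- by rewrite block_mxEur !mxE -val_eqE /= ord1.
- by rewrite block_mxEdl !mxE -val_eqE /= ord1.
- rewrite block_mxEdr !mxE -!val_eqE /= (_ : rshift 1 i' = lift ord0 i') //; exact/val_inj.
Qed.

Lemma block_mx_of_column (A : nzRingType) n (M : 'M[A]_(1 + n)) :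
  M *m delta_mx 0 0 = delta_mx 0 0 :> 'cV_(1 + n) ->
  M = block_mx 1%:M (ursubmx M) 0 (drsubmx M).
Proof.
rewrite -colE => Mc.
have M0 a : M a (lshift n (0 : 'I_1)) = (a == lshift n (0 : 'I_1))%:R.
  have l0 : 0 = lshift n (0 : 'I_1) :> 'I_(1 + n) by exact/val_inj.
  by have := congr1 (fun N : 'cV_(1 + n) => N a 0) Mc; rewrite !mxE andbT -l0.
rewrite -[LHS]submxK; congr (block_mx _ _ _ _).
  by apply/matrixP=> i j; rewrite !ord1 !mxE M0.
by apply/matrixP=> i j; rewrite !ord1 !mxE M0.
Qed.

(** * Splitting off diagonal entries by reduction modulo [p] *)

Section Reduction.
Variables (A Ab : idomainType) (pi : {rmorphism A -> Ab}) (p : A).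
Hypotheses (surj : forall x, exists y, pi y = x).
Hypotheses (ker_pi : forall x, pi x = 0 -> exists y, x = p * y) (pip : pi p = 0).
Hypotheses (herm : column_lift (idfun : A -> A)) (lift_pi : column_lift pi).
Hypothesis free : proj_free Ab.

(** [F G] is idempotent with the same image as [F], so this image is free, and nonzero; a basis
    vector is unimodular because [Z W = 1]. *)
Lemma unimodular_image l (F : 'M[Ab]_l) r :
    minor_ideal F r 1 -> F != 0 ->
    (forall f g : 'I_r.+1 -> 'I_l, \det (mxsub f g F) = 0) ->
  exists (v : 'cV[Ab]_l) (z : 'rV[Ab]_l), z *m (F *m v) = 1%:M.
Proof.
move=> F1 nzF F0; have [G FGF] := generalized_inverse F1 F0.
have EE : F *m G *m (F *m G) = F *m G by rewrite mulmxA FGF.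
have [[|q] [W [Z [WZ ZW]]]] := free EE.
  by case/eqP: nzF; rewrite -FGF -WZ [W]thinmx0 !mul0mx.
exists (G *m (W *m delta_mx 0 0)), (delta_mx 0 0 *m Z).
have FGW : F *m G *m W = W by rewrite -WZ -mulmxA ZW mulmx1.
rewrite [F *m _]mulmxA [F *m G *m _]mulmxA FGW mulmxA -(mulmxA (delta_mx 0 0)) ZW mulmx1.
by rewrite mul_delta_mx; apply/matrixP=> i j; rewrite !ord1 !mxE.
Qed.

Lemma split_unit_block m (F : 'M[A]_m.+2) r k :
    minor_ideal F 1 1 -> minor_ideal F r 1 ->
    (forall f g : 'I_r.+1 -> 'I_m.+2, exists c, \det (mxsub f g F) = c * p) ->
    minor_ideal F m.+2 (p ^+ k) ->
  exists F' : 'M[A]_m.+1, mx_equiv F (block_mx 1%:M 0 0 F' : 'M_(1 + m.+1)).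
Proof.
move=> F1 Fr Fr1 Fp.
have := minor_ideal_map (pi := pi) F1; rewrite rmorph1 => /minor_ideal1_neq0 nz_piF.
have := minor_ideal_map (pi := pi) Fr; rewrite rmorph1 => piFr.
have [|v [z zFv]] := unimodular_image piFr nz_piF.
  by move=> f g; rewrite -map_mxsub det_map_mx; have [c ->] := Fr1 f g; rewrite rmorphM pip mulr0.
have zFv' : z *m map_mx pi F *m v = 1%:M by rewrite -mulmxA.
(* [v] is unimodular too, with left inverse [z F] modulo [p], so it is the reduction of the first
   column of some [H] of determinant 1. *)
have [H [dH Hv]] := sl_equiv_sym (lift_pi zFv').
pose c := F *m H *m delta_mx 0 0 : 'cV_m.+2.
have pic : map_mx pi c = map_mx pi F *m v.
  by rewrite -Hv !map_mxM map_delta_mx mulmxA.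
have [Zl Zlz] := map_mx_surj surj z.
have [y Zlc] : exists y, Zl *m c = (1 + p * y)%:M.
  have : pi ((Zl *m c) 0 0 - 1) = 0.
    rewrite rmorphB rmorph1.
    have -> : pi ((Zl *m c) 0 0) = (map_mx pi (Zl *m c)) 0 0 by rewrite [RHS]mxE.
    by rewrite map_mxM Zlz pic zFv mxE eqxx subrr.
  move=> /ker_pi[y e]; exists y; rewrite [LHS]mx11_scalar; congr (_%:M).
  by rewrite -e addrC subrK.
(* The first row of [\adj (F H)] sends the first column [c] of [F H] to [\det F], which divides
   [p^k]. *)
have [w wc] : exists w : 'rV_m.+2, w *m c = (p ^+ k)%:M.
  have [e ->] : exists e, p ^+ k = e * \det F.
    apply: (Fp (fun x => exists e, x = e * \det F)) => [|f g]; first exact: ideal_multiples.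
    have -> : mxsub f g F = rowsub f 1%:M *m F *m colsub g 1%:M.
      by rewrite mulmx_colsub mulmx1 mul_rowsub_mx mul1mx; apply/matrixP=> a b; rewrite !mxE.
    exists (\det (rowsub f (1%:M : 'M[A]_m.+2)) * \det (colsub g (1%:M : 'M[A]_m.+2))).
    by rewrite !det_mulmx mulrAC.
  exists (e *: (delta_mx 0 0 *m \adj (F *m H))).
  rewrite -scalemxAl /c.
  have -> : delta_mx 0 0 *m \adj (F *m H) *m (F *m H *m delta_mx 0 0) =
      delta_mx 0 0 *m (\adj (F *m H) *m (F *m H)) *m delta_mx 0 0 :> 'M_1 by rewrite !mulmxA.
  rewrite mul_adj_mx det_mulmx dH mulr1 mul_mx_scalar -scalemxAl mul_delta_mx scalerA.
  by apply/matrixP=> a b; rewrite !ord1 !mxE !mulr1.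
have [z' z'c] := unimodular_of_power Zlc wc.
have [H' [dH' H'c]] := herm z'c; rewrite map_mx_id // in H'c.
pose F2 : 'M_(1 + m.+1) := H' *m F *m H.
pose b : 'rV_m.+1 := ursubmx F2; pose F' : 'M_m.+1 := drsubmx F2.
have F2E : F2 = block_mx 1%:M b 0 F'.
  have F2c : F2 *m delta_mx 0 0 = delta_mx 0 0 :> 'cV_m.+2.
    by rewrite -[RHS]H'c /F2 /c !mulmxA.
  exact: block_mx_of_column.
exists F'; apply: (@mx_equiv_trans _ _ _ (F2 : 'M_m.+2)).
  apply: mx_equiv_sym; exists H', H; rewrite !unitmxE dH dH' unitr1; split=> //.
exists 1%:M, (block_mx 1%:M b 0 1%:M); split; first exact: unitmx1.
  by rewrite unitmxE (@det_ublock _ 1 m.+1) !det1 mulr1 unitr1.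
rewrite F2E mul1mx (@mulmx_block _ 1 m.+1 1 m.+1 1 m.+1).
by rewrite !mul0mx !mulmx0 !mul1mx !mulmx1 !addr0 add0r.
Qed.

Lemma smith_of_minors l (F : 'M[A]_l) (s : 'I_l -> nat) :
    p != 0 -> {homo s : i j / (i <= j)%N} ->
    (forall i, (i <= l)%N -> minor_ideal F i (p ^+ partial_sum s i)) ->
    (forall i, (i <= l)%N -> minors_dvd F i (p ^+ partial_sum s i)) ->
  mx_equiv F (diag_mx (\row_i p ^+ s i)).
Proof.
move=> nz_p; elim: l F s => [|l IHl] F s s_mono Fgen Fdvd.
  by rewrite [diag_mx _]flatmx0 [F]flatmx0; exact: mx_equiv_refl.
pose a := s ord0; pose s1 j := (s j - a)%N.
have nz_pn n : p ^+ n != 0 by rewrite expf_neq0.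
have [F0 FE] : exists F0, F = p ^+ a *: F0.
  have /boolp.choice[f fP] : forall ij : 'I_l.+1 * 'I_l.+1, exists c, F ij.1 ij.2 = p ^+ a * c.
    move=> [i j]; have [c] := Fdvd 1%N isT (fun=> i) (fun=> j).
    rewrite det_mx11 mxE partial_sumS /partial_sum big1 // addn0 => e.
    by exists c; rewrite mulrC.
  by exists (\matrix_(i, j) f (i, j)); apply/matrixP=> i j; rewrite !mxE -fP.
have psE i : (i <= l.+1)%N -> partial_sum s i = (i * a + partial_sum s1 i)%N.
  by move=> le_i; apply: partial_sum_sub => // j; exact: s_mono.
have detE i (f g : 'I_i -> 'I_l.+1) : \det (mxsub f g F) = p ^+ (i * a) * \det (mxsub f g F0).
  rewrite FE mulnC exprM -detZ; congr (\det _).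
  by apply/matrixP=> u v; rewrite !mxE.
have F0gen i : (i <= l.+1)%N -> minor_ideal F0 i (p ^+ partial_sum s1 i).
  move=> le_i I idI IF0.
  (* The ideal [p^(i a) I] contains the minors of size [i] of [F]; the power of [p] is cancelled
     afterwards. *)
  have [||y [+ Iy]] := Fgen i le_i (fun x => exists y, x = p ^+ (i * a) * y /\ I y).
  - split=> [|c u v [u' [-> Iu]] [v' [-> Iv]]].
      by exists 0; rewrite mulr0; split=> //; case: idI.
    exists (c * u' + v'); split; last exact: idI.2.
    by rewrite mulrDr mulrCA.
  - by move=> f g; exists (\det (mxsub f g F0)).
  by rewrite psE // exprD => /(mulfI (nz_pn _)) ->.
have F0dvd i : (i <= l.+1)%N -> minors_dvd F0 i (p ^+ partial_sum s1 i).
  move=> le_i f g; have [c] := Fdvd i le_i f g.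
  rewrite detE psE // exprD mulrCA => /(mulfI (nz_pn _)) e; by exists c.
suff F0S : mx_equiv F0 (diag_mx (\row_i p ^+ s1 i)).
  rewrite FE (_ : diag_mx _ = p ^+ a *: diag_mx (\row_i p ^+ s1 i)); first exact: mx_equiv_scale.
  rewrite -linearZ; congr diag_mx; apply/rowP=> j; rewrite !mxE -exprD subnKC //.
  exact: s_mono.
have s1_0 : s1 ord0 = 0%N by rewrite /s1 subnn.
have ps1 : partial_sum s1 1 = 0%N by rewrite partial_sumS s1_0 /partial_sum big1.
have F0_1 : minor_ideal F0 1 1 by have := F0gen 1%N isT; rewrite ps1 expr0.
(* Size 1 is apart, since unimodular columns are completed from length 2 on; there the only entry is
   a unit. *)
case: l => [|m] in IHl F s s_mono Fgen Fdvd a s1 F0 FE psE detE F0gen F0dvd s1_0 ps1 F0_1 *.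
  have [c cF] : exists c, 1 = c * F0 0 0.
    apply: (F0_1 (fun x => exists c, x = c * F0 0 0)) => [|f g]; first exact: ideal_multiples.
    by exists 1; rewrite mul1r det_mx11 mxE !ord1.
  have -> : diag_mx (\row_i p ^+ s1 i) = 1%:M.
    by apply/matrixP=> i j; rewrite !ord1 !mxE (_ : 0 = ord0) ?s1_0.
  exists F0, 1%:M; rewrite unitmx1 !mulmx1 unitmxE det_mx11; split=> //.
  by apply/unitrPr; exists c; rewrite mulrC; exact/esym.
(* [r] is the rank modulo [p]: the last size for which the minors of [F0] generate the unit ideal.
   The next ones are divisible by [p]. *)
have [|i /andP[] //|r /andP[le_r /eqP r0] maxr] := @ex_maxnP
    (fun i => (i <= m.+2)%N && (partial_sum s1 i == 0%N)) m.+2.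
  by exists 0%N; rewrite /partial_sum big1.
have F0_r : minor_ideal F0 r 1 by have := F0gen r le_r; rewrite r0 expr0.
have F0_r1 (f g : 'I_r.+1 -> 'I_m.+2) : exists c, \det (mxsub f g F0) = c * p.
  have [lt_r|ge_r] := ltnP r m.+2; last first.
    exists 0; rewrite mul0r minor_not_inj // => /leq_card; rewrite !card_ord.
    by rewrite leqNgt ltnS ge_r.
  have : partial_sum s1 r.+1 != 0%N.
    by apply: contraTneq isT => e; have := maxr r.+1; rewrite lt_r e eqxx ltnn => /(_ isT).
  have [c ->] := F0dvd r.+1 lt_r f g; case: (partial_sum s1 r.+1) => // e _.
  by exists (c * p ^+ e); rewrite exprSr mulrA.
have [F' F0F'] := split_unit_block F0_1 F0_r F0_r1 (F0gen _ (leqnn _)).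
pose s2 (j : 'I_m.+1) := s1 (lift ord0 j).
have ps2 i : partial_sum s2 i = partial_sum s1 i.+1 by rewrite partial_sumS s1_0.
have : mx_equiv F' (diag_mx (\row_i p ^+ s2 i)).
  apply: IHl => [i j le_ij|i le_i|i le_i f g].
  - by apply: leq_sub2r; apply: s_mono; rewrite !lift0.
  - rewrite ps2; apply: minor_ideal_unit_block.
    exact: minor_ideal_mx_equiv F0F' (F0gen i.+1 le_i).
  - have [f1 [g1 ->]] := minor_unit_block F' f g; rewrite ps2.
    exact: (minors_dvd_mx_equiv (mx_equiv_sym F0F') (F0dvd i.+1 le_i)).
move/mx_equiv_block => F'S; apply: (mx_equiv_trans F0F').
rewrite [X in mx_equiv _ X]diag_mx_unit_block; last by rewrite mxE (_ : 0 = ord0) // s1_0 expr0.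
rewrite (_ : \row_j _ = \row_i p ^+ s2 i) //.
by apply/rowP=> j; rewrite !mxE.
Qed.

End Reduction.

(** * The polynomial rings of the statement *)

(** A residue field only kills [p]; that its kernel is no larger follows from Bezout, as [x] prime
    to [p] in the kernel would put [1] there. *)
Lemma polynomial_residue_field (K : fieldType) (p : {poly K}) :
    irreducible_poly p ->
  exists (L : fieldType) (pi : {rmorphism {poly K} -> L}),
    [/\ forall x, exists y, pi y = x, pi p = 0 &
        forall x, pi x = 0 -> exists y, x = p * y].
Proof.
move=> [sz_p irr_p].
have [||L [pi [surj pi0]]] := @residue_field {poly K} (fun x => exists c, x = c * p).
- exact: ideal_multiples.
- move=> [c one]; have : p %| 1 by rewrite one dvdp_mull.
  by rewrite dvdp1 => /eqP sz1; rewrite sz1 in sz_p.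
exists L, pi; split=> //; first by apply: pi0; exists 1; rewrite mul1r.
move=> x pix; have [/dvdpP[q ->]|ndvd] := boolP (p %| x); first by exists q; rewrite mulrC.
have : coprimep p x.
  rewrite /coprimep; apply: contraNT ndvd => /irr_p/(_ (dvdp_gcdl p x)) eq_p.
  by rewrite -(eqp_dvdl _ eq_p) dvdp_gcdr.
move=> /Bezout_eq1_coprimepP[[u v] /= one].
have : pi (u * p + v * x) = 0.
  by rewrite rmorphD !rmorphM pix (pi0 p) ?mulr0 ?addr0 //; exists 1; rewrite mul1r.
by rewrite one rmorph1 => /eqP; rewrite oner_eq0.
Qed.

Fixpoint iter_const (R : idomainType) (n : nat) : R -> iter_poly R n :=
  if n is m.+1 return R -> iter_poly R n then fun c => (iter_const m c)%:P else id.

Lemma iter_map_const (R S : idomainType) (f : {rmorphism R -> S}) n c :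
  iter_map f n (iter_const n c) = iter_const n (f c).
Proof. by elim: n => //= n IHn; rewrite map_polyC /= IHn. Qed.

Lemma iter_const0 (R : idomainType) n : iter_const n (0 : R) = 0.
Proof. by elim: n => //= n ->. Qed.

Lemma iter_map_ker (R S : idomainType) (f : {rmorphism R -> S}) (p : R) n :
    (forall x, f x = 0 -> exists y, x = p * y) ->
  forall x, iter_map f n x = 0 -> exists y, x = iter_const n p * y.
Proof.
move=> ker; elim: n => //= n IHn; elim/poly_ind => [|x c IHx].
  by exists 0; rewrite mulr0.
rewrite rmorphD rmorphM /= map_polyX map_polyC /= => e.
have fc : iter_map f n c = 0.
  by have := congr1 (fun q : {poly _} => q`_0) e; rewrite coefD coefMX coefC add0r coef0.
have fx : map_poly (iter_map f n) x = 0.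
  apply/polyP=> i; have := congr1 (fun q : {poly _} => q`_i.+1) e.
  by rewrite coefD coefMX coefC addr0 !coef0.
have [y ->] := IHn c fc; have [z ->] := IHx fx.
by exists (z * 'X + y%:P); rewrite mulrDr mulrA polyCM.
Qed.

(** Allows the innermost variable to be counted either among the variables or in the coefficient
    ring. *)
Lemma iter_polyS_iso (R : idomainType) n :
  exists (u : {rmorphism iter_poly R n.+1 -> iter_poly {poly R} n})
         (v : {rmorphism iter_poly {poly R} n -> iter_poly R n.+1}),
    cancel u v /\ cancel v u.
Proof.
elim: n => [|n [u [v [uK vK]]]]; first by exists idfun, idfun.
exists (map_poly u : {rmorphism {poly iter_poly R n.+1} -> {poly iter_poly {poly R} n}}).
exists (map_poly v : {rmorphism {poly iter_poly {poly R} n} -> {poly iter_poly R n.+1}}).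
by split=> x /=; rewrite -map_poly_comp (eq_map_poly (g := idfun)) ?map_poly_id.
Qed.

Lemma column_lift_transport (A Ab B Bb : comNzRingType)
    (pi : {rmorphism A -> Ab}) (pi' : {rmorphism B -> Bb})
    (v : {rmorphism A -> B}) (ub : {rmorphism Bb -> Ab}) (vb : {rmorphism Ab -> Bb}) :
    cancel ub vb -> (forall x, pi' (v x) = vb (pi x)) ->
  column_lift pi -> column_lift pi'.
Proof.
move=> ubK piE lift_pi m c z zc.
have [|H [dH Hc]] := lift_pi m (map_mx ub c) (map_mx ub z).
  by rewrite -map_mxM zc map_mx1.
exists (map_mx v H); rewrite det_map_mx dH rmorph1; split=> //.
rewrite -(map_delta_mx vb) -Hc map_mxM; congr (_ *m _).
  by apply/matrixP=> i j; rewrite !mxE piE.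
by apply/matrixP=> i j; rewrite !mxE ubK.
Qed.

Lemma mpoly_rmorph_eq n (R : comNzRingType) (S : nzRingType)
    (u v : {rmorphism {mpoly R[n]} -> S}) :
    (forall c, u c%:MP = v c%:MP) -> (forall i, u 'X_i = v 'X_i) -> u =1 v.
Proof.
move=> uvC uvX p; rewrite [p]mpolyE !rmorph_sum; apply: eq_bigr => m _ /=.
rewrite -!mul_mpolyC !rmorphM /= uvC; congr (_ * _).
rewrite mpolyXE_id !rmorph_prod; apply: eq_bigr => i _ /=.
by rewrite !rmorphXn /= uvX.
Qed.

(** * Multivariate polynomials as iterated polynomials *)

Section Muni.
Variables (K : fieldType) (n : nat).

Definition muni_inv : {rmorphism {poly {mpoly K[n]}} -> {mpoly K[n.+1]}} :=
  horner_eval ('X_ord_max : {mpoly K[n.+1]}) \o map_poly (@mwiden n K).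

Lemma muni_widen i : muni ('X_(widen_ord (leqnSn n) i) : {mpoly K[n.+1]}) = ('X_i)%:P.
Proof.
rewrite /muni mmapX mmap1U; case: splitP => [j /= ej|j /= ej].
  by congr ('X__)%:P; apply/val_inj; rewrite /= ej.
by have := ltn_ord i; rewrite ej ord1 addn0 ltnn.
Qed.

Lemma muni_max : muni ('X_ord_max : {mpoly K[n.+1]}) = 'X.
Proof.
rewrite /muni mmapX mmap1U; case: splitP => [j /= ej|//].
by have := ltn_ord j; rewrite -ej ltnn.
Qed.

Lemma mwiden_X (i : 'I_n) : mwiden ('X_i : {mpoly K[n]}) = 'X_(widen_ord (leqnSn n) i).
Proof. by rewrite /mwiden mmapX mmap1U. Qed.

Lemma muniK : cancel (@muni n K) muni_inv.
Proof.
apply: (@mpoly_rmorph_eq _ _ _ (muni_inv \o @muni n K) idfun) => [c|i] /=.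
  by rewrite muniC map_polyC /= mwidenC /horner_eval hornerC.
case: (unliftP ord_max i) => [j ->|->] /=.
  have -> : lift ord_max j = widen_ord (leqnSn n) j.
    by apply/val_inj; rewrite /= /bump leqNgt ltn_ord.
  by rewrite muni_widen map_polyC /= mwiden_X /horner_eval hornerC.
by rewrite muni_max map_polyX /horner_eval hornerX.
Qed.

Lemma muni_invK : cancel muni_inv (@muni n K).
Proof.
have muni_w : @muni n K \o @mwiden n K =1 polyC.
  apply: (@mpoly_rmorph_eq _ _ _ (@muni n K \o @mwiden n K) polyC) => [c|i] /=.
    by rewrite mwidenC muniC.
  by rewrite mwiden_X muni_widen.
elim/poly_ind => [|p c IHp]; first by rewrite !rmorph0.
rewrite !rmorphD !rmorphM /= map_polyX map_polyC /= /horner_eval hornerX hornerC.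
by rewrite muni_max; congr (_ * _ + _); [exact: IHp|exact: muni_w].
Qed.

End Muni.

Lemma in_x1_recl (K : fieldType) n (p : {poly K}) (c : K) :
  in_x1 n (p * 'X + c%:P) = in_x1 n p * 'X_ord0 + c%:MP.
Proof. by rewrite /in_x1 rmorphD rmorphM /= horner_algX horner_algC alg_mpolyC. Qed.

(** [muni] peels off the last variable, so [x_1] ends up innermost, in the base ring [K[x_1]], where
    [p] is a constant. *)
Lemma mpoly_iter_iso (K : fieldType) n :
  exists (u : {rmorphism {mpoly K[n.+1]} -> iter_poly {poly K} n})
         (v : {rmorphism iter_poly {poly K} n -> {mpoly K[n.+1]}}),
    [/\ cancel u v, cancel v u & forall p, u (in_x1 n p) = iter_const n p].
Proof.
elim: n => [|n [u [v [uK vK u_in]]]].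
  pose u : {rmorphism {mpoly K[1]} -> {poly K}} := mmap polyC (fun _ => 'X).
  pose v : {rmorphism {poly K} -> {mpoly K[1]}} := horner_alg ('X_ord0 : {mpoly K[1]}).
  have u_in p : u (in_x1 0 p) = p.
    elim/poly_ind: p => [|p c IHp]; first by rewrite /in_x1 !rmorph0.
    by rewrite in_x1_recl rmorphD rmorphM IHp /= mmapX mmap1U mmapC.
  exists u, v; split=> //; apply: (@mpoly_rmorph_eq _ _ _ (v \o u) idfun) => [c|i] /=.
    by rewrite mmapC /= horner_algC alg_mpolyC.
  by rewrite mmapX mmap1U /= horner_algX (ord1 i).
exists (map_poly u \o @muni n.+1 K : {rmorphism {mpoly K[n.+2]} -> {poly iter_poly {poly K} n}}).
exists (muni_inv K n.+1 \o map_poly v : {rmorphism {poly iter_poly {poly K} n} -> {mpoly K[n.+2]}}).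
have vu y : map_poly v (map_poly u y) = y.
  by rewrite -map_poly_comp (eq_map_poly (g := idfun)) ?map_poly_id.
have uv y : map_poly u (map_poly v y) = y.
  by rewrite -map_poly_comp (eq_map_poly (g := idfun)) ?map_poly_id.
split=> [x|x|p].
- by rewrite -[RHS]muniK -[muni x in RHS]vu.
- by rewrite -[RHS]uv -[map_poly v x in RHS]muni_invK.
- rewrite /=; have -> : muni (in_x1 n.+1 p) = (in_x1 n p)%:P.
    elim/poly_ind: p => [|p c IHp]; first by rewrite /in_x1 !rmorph0.
    rewrite !in_x1_recl rmorphD rmorphM /= IHp muniC polyCD polyCM; congr (_ * _ + _).
    by rewrite -muni_widen; congr (muni 'X__); apply/val_inj.
  by rewrite map_polyC /= u_in.
Qed.

Lemma iter_const_eq0 (R : idomainType) n (c : R) : iter_const n c = 0 -> c = 0.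
Proof. by elim: n => //= n IHn /eqP; rewrite polyC_eq0 => /eqP. Qed.

(** * Reduced minors and the Smith form *)

Lemma ideal_gen_is_ideal (A : idomainType) (S : A -> Prop) : is_ideal (ideal_gen S).
Proof.
split=> [|a _ _ [k1 [b1 [c1 [S1 ->]]]] [k2 [b2 [c2 [S2 ->]]]]].
  by exists 0%N, (fun=> 0), (fun=> 0); split; [case|rewrite big_ord0].
exists (k1 + k2)%N.
exists (fun j => match split j with inl j1 => b1 j1 | inr j2 => b2 j2 end).
exists (fun j => match split j with inl j1 => a * c1 j1 | inr j2 => c2 j2 end).
split=> [j|]; first by case: (split j).
rewrite big_split_ord /= mulr_sumr; congr (_ + _); apply: eq_bigr => j _.
  by rewrite (unsplitK (inl _ j)) mulrA.
by rewrite (unsplitK (inr _ j)).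
Qed.

Lemma ideal_gen_in (A : idomainType) (S : A -> Prop) x : S x -> ideal_gen S x.
Proof.
by move=> Sx; exists 1%N, (fun=> x), (fun=> 1); split=> //; rewrite big_ord1 mul1r.
Qed.

Lemma minors_dvd_of_is_d (A : idomainType) l m (F : 'M[A]_(l, m)) i d :
  is_d F i d -> minors_dvd F i d.
Proof.
move=> [dF _] f g; apply: (@ideal_sorted_minors _ _ _ F i (fun x => exists c, x = c * d)) => //.
exact: ideal_multiples.
Qed.

(** All minors lie in the ideal [d J], hence so does [d], and cancelling [d] gives [1] in [J]. *)
Lemma J_full_of_minor_ideal (A : idomainType) l m (F : 'M[A]_(l, m)) i d :
  d != 0 -> is_d F i d -> minor_ideal F i d -> forall x, J F i x.
Proof.
move=> nz_d dF Fd x; have [J0 idJ] := ideal_gen_is_ideal (is_reduced_minor F i).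
have idI : is_ideal (fun y => exists z, y = d * z /\ J F i z).
  split=> [|a _ _ [u [-> Ju]] [v [-> Jv]]]; first by exists 0; rewrite mulr0.
  by exists (a * u + v); split; [rewrite mulrDr mulrCA|exact: idJ].
have [|y [e Jy]] := Fd _ idI.
  move=> f g; apply: (ideal_sorted_minors f g idI) => a Fa.
  have [c ac] := dF.1 a Fa; exists c; split; first by rewrite mulrC.
  by apply: ideal_gen_in; exists d, a; split=> //; rewrite mulrC.
have y1 : y = 1 by apply: (mulfI nz_d); rewrite mulr1.
by rewrite -[x]mulr1 -y1 -[_ * _]addr0; exact: idJ.
Qed.

Lemma minor_ideal_of_J (A : idomainType) l m (F : 'M[A]_(l, m)) i d :
  is_d F i d -> J F i 1 -> minor_ideal F i d.
Proof.
move=> dF [k [b [c [bF one]]]] I idI IF.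
rewrite -[d]mulr1 one mulr_sumr; apply: ideal_sum => // j _.
have [d' [a [d'F aF ab]]] := bF j.
(* Each reduced minor comes with its own gcd [d']; as [d'] divides [d], the product [d b] is a
   multiple of the minor [a]. *)
have [u du] : rdivides d' d by apply: dF.2; exact: d'F.1.
rewrite mulrCA du -mulrA -ab; do 2![apply: idealM => //].
by case: aF => f [g [_ _ ->]].
Qed.

Lemma minor_ideal_diag (A : idomainType) l (p : A) (s : 'I_l -> nat) i :
  (i <= l)%N -> minor_ideal (diag_mx (\row_j p ^+ s j)) i (p ^+ partial_sum s i).
Proof.
move=> le_il I idI IF.
have <- : \det (mxsub (widen_ord le_il) (widen_ord le_il) (diag_mx (\row_j p ^+ s j))) =
    p ^+ partial_sum s i; last exact: IF.
have -> : mxsub (widen_ord le_il) (widen_ord le_il) (diag_mx (\row_j p ^+ s j)) =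
    diag_mx (\row_j p ^+ s (widen_ord le_il j)).
  by apply/matrixP=> a b; rewrite !mxE -val_eqE.
rewrite det_diag /partial_sum (big_ord_narrow le_il) -prodrXr.
by apply: eq_bigr => j _; rewrite mxE.
Qed.

Lemma partial_sum_recr l (s : 'I_l -> nat) i (lt_il : (i < l)%N) :
  partial_sum s i.+1 = (partial_sum s i + s (Ordinal lt_il))%N.
Proof.
rewrite /partial_sum (bigD1 (Ordinal lt_il)) //= addnC; congr (_ + _)%N.
by apply: eq_bigl => j; rewrite -val_eqE /= ltnS andbC -ltn_neqAle.
Qed.

Lemma smith_is_d (A : idomainType) l (F : 'M[A]_l) (p : A) (s : 'I_l -> nat) i :
    is_smith_form F (diag_mx (\row_j p ^+ s j)) -> (1 <= i <= l)%N ->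
  is_d F i (p ^+ partial_sum s i).
Proof.
move=> [_ _ [d [d0 dF dS]]] le_i.
suff -> : p ^+ partial_sum s i = d i by exact: dF.
case/andP: le_i => _; elim: i => [|i IHi] le_i.
  by rewrite d0 /partial_sum big1.
rewrite (dS (Ordinal le_i)) -IHi 1?ltnW // !mxE eqxx mulr1n -exprD.
by rewrite (partial_sum_recr _ le_i) addnC.
Qed.

Theorem theorem3p4 (K : fieldType) (n l t : nat)
    (F : 'M[{mpoly K[n.+1]}]_l) (p : {poly K}) (s : 'I_l -> nat)
    (p_irr : irreducible_poly p)
    (t_gt0 : (0 < t)%N)
    (detF : \det F = in_x1 n p ^+ t)
    (s_mono : {homo s : i j / (i <= j)%N})
    (smithF : is_smith_form F (diag_mx (\row_(i < l) in_x1 n p ^+ s i))) :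
  mx_equiv F (diag_mx (\row_(i < l) in_x1 n p ^+ s i)) <->
  (forall i : nat, (1 <= i <= l)%N ->
    forall x : {mpoly K[n.+1]}, J F i x).
Proof.
set P := in_x1 n p.
have [u [v [uK vK u_in]]] := mpoly_iter_iso K n.
have nz_P : P != 0.
  apply: contraTneq p_irr.1 => P0; have := u_in p; rewrite -/P P0 rmorph0.
  by move/esym/iter_const_eq0 => ->; rewrite size_poly0.
have dF i : (1 <= i <= l)%N -> is_d F i (P ^+ partial_sum s i) by exact: smith_is_d smithF.
split=> [FS i le_i|JF].
  apply: J_full_of_minor_ideal (dF i le_i) _; first by rewrite expf_neq0.
  apply: minor_ideal_mx_equiv (mx_equiv_sym FS) _.
  by apply: minor_ideal_diag; case/andP: le_i.
have [L [pi0 [surj0 pip ker0]]] := polynomial_residue_field p_irr.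
(* Reduction modulo [p], onto the ring of polynomials in the other variables over [L = K[x_1] /
   (p)]. *)
pose pi : {rmorphism {mpoly K[n.+1]} -> iter_poly L n} := iter_map pi0 n \o u.
have piE x : pi x = iter_map pi0 n (u x) by [].
have surj x : exists y, pi y = x.
  have [y <-] := iter_map_surj (n := n) surj0 x.
  by exists (v y); rewrite piE vK.
have ker x : pi x = 0 -> exists y, x = P * y.
  rewrite piE => /(iter_map_ker ker0)[y uxy]; exists (v y).
  by rewrite -[x]uK uxy -u_in rmorphM /= uK.
have piP : pi P = 0 by rewrite piE u_in iter_map_const pip iter_const0.
have herm : column_lift (idfun : {mpoly K[n.+1]} -> {mpoly K[n.+1]}).
  (* Here [x_1] counts as a variable over the field [K]; for [lift_pi] it belongs to the base ring
     [K[x_1]]. *)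
  have [u' [v' [uK' vK']]] := iter_polyS_iso K n.
  apply: (@column_lift_transport _ _ _ _ idfun idfun (v \o u') (v' \o u) (v \o u'))
    (column_lift_id (n := n.+1)) => //.
  by move=> x /=; rewrite vK' uK.
have lift_pi : column_lift pi.
  apply: (@column_lift_transport _ _ _ _ (iter_map pi0 n) pi v idfun idfun)
    (column_lift_iter surj0) => //.
  by move=> x /=; rewrite vK.
apply: (smith_of_minors surj ker piP herm lift_pi (proj_free_iter (n := n))) => // i le_i.
  (* The hypotheses start at size 1; in size 0 the only minor is the empty determinant 1. *)
  have [->|i_gt0] := posnP i.
    move=> I idI IF; rewrite /partial_sum big1 // expr0.
    have f : 'I_0 -> 'I_l by case.
    by have := IF f f; rewrite det_mx00.
  by apply: minor_ideal_of_J; [apply: dF|apply: JF]; rewrite i_gt0.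
have [->|i_gt0] := posnP i.
  by move=> f g; rewrite /partial_sum big1 // expr0; exists (\det (mxsub f g F)); rewrite mulr1.
by apply: minors_dvd_of_is_d; apply: dF; rewrite i_gt0.
Qed.
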